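(* There is an absolute constant $C>0$ such that for every $0<\varepsilon\le1$ and $d\in\mathbb{N}$ there exist $\varepsilon',d'>0$ with the following property. For every $n,m$ and all polynomials $P_1,\dots,P_n\colon\mathbb{F}_2^m\to\mathbb{F}_2$ of degree at most $d$, the distribution $\mathcal{P}$ of $(P_1(X),\dots,P_n(X))$ for $X$ uniform on $\mathbb{F}_2^m$ satisfies \[ \|\mathcal{P}-\mathrm{Ber}(1/3)^{\otimes n}\|_{\mathtt{TV}}\ \ge\ 1-C d' n^{-\varepsilon'}-C\varepsilon . \] Consequently, for each fixed $d$ there is a function $\eta_d(n)\to0$ as $n\to\infty$ such that every such $\mathcal{P}$ satisfies $\|\mathcal{P}-\mathrm{Ber}(1/3)^{\otimes n}\|_{\mathtt{TV}}\ge1-\eta_d(n)$.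
   Context: Total variation distance: $\frac12\sum_x|\mathcal{D}_1(x)-\mathcal{D}_2(x)|$; $\mathrm{Ber}(1/3)^{\otimes n}$ is the product of $n$ independent Bernoulli$(1/3)$ bits. *)

(* Defs.v *)
From HB Require Import structures.
From mathcomp Require Import all_boot all_order all_algebra.
From mathcomp Require Import all_classical all_reals all_analysis.
From mathcomp Require Import Rstruct Rstruct_topology.
From Stdlib Require Import Rdefinitions.
Set Implicit Arguments. Unset Strict Implicit. Unset Printing Implicit Defensive.
Import Order.TTheory GRing.Theory Num.Theory.
Local Open Scope ring_scope.

Definition F2vec (k : nat) : finType := 'rV['F_2]_k.

(* A function F_2^m -> F_2 is a polynomial of degree at most d iff it is
   given by a polynomial expression in the coordinates of degree <= d; since
   x^2 = x on F_2, this is the same as a multilinear expression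
   sum_{S, |S| <= d} c_S prod_{i in S} x_i. *)
Definition poly_deg_le (m d : nat) (f : F2vec m -> 'F_2) : Prop :=
  exists c : {set 'I_m} -> 'F_2,
    (forall S : {set 'I_m}, (d < #|S|)%nat -> c S = 0) /\
    forall x : F2vec m, f x = \sum_(S : {set 'I_m}) c S * \prod_(i in S) x ord0 i.

Definition poly_law (n m : nat) (P : 'I_n -> F2vec m -> 'F_2) (y : F2vec n) : R :=
  (#|[set x : F2vec m | (\row_i P i x) == y]|%:R / (2 ^+ m)).

Definition ber13n (n : nat) (y : F2vec n) : R :=
  \prod_(i < n) (if y ord0 i == 1 then 1 / 3 else 2 / 3).

Definition tv_dist (T : finType) (p q : T -> R) : R :=
  (1 / 2) * \sum_(x : T) `|p x - q x|.

(* Main.v *)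
Require Import Defs.
From HB Require Import structures.
From mathcomp Require Import all_boot all_order all_algebra.
From mathcomp Require Import all_classical all_reals all_analysis.
From mathcomp Require Import Rstruct Rstruct_topology.
From Stdlib Require Import Rdefinitions.
From mathcomp Require Import ssrnat ring lra.
Set Implicit Arguments. Unset Strict Implicit. Unset Printing Implicit Defensive.
Import Order.TTheory GRing.Theory Num.Theory.
Import numFieldNormedType.Exports.
Local Open Scope classical_set_scope.
Local Open Scope ring_scope.

(* As eps' and d' may depend on eps and d, both assertions say that the distance tends to 1 as n
   grows, uniformly in m and in the P_i. Dropping outputs decreases the distance, so by Ramsey's
   theorem one may assume that the correlations E (-1)^(P_i + P_j), i <> j, are nearly equal. Then
   for most pairs x, y the empirical correlation of (P_i x)_i and (P_i y)_i nearly factorises.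
   If the average of (-1)^(P_i x) over i were close to 1/3 on a set of x of positive density, this
   set would contain a cube x + F_2^k Y all pairs of which factorise, and by the second moment
   method some P_i restricted to that cube would have a bias close to 1/3. The test
   "the average of (-1)^(y_i) is close to 1/3" thus separates the two distributions as soon as the
   biases of the polynomials of degree at most d stay away from 1/3.

   If they did not, some sequence of such polynomials would have biases tending to 1/3; consider
   limit functions along an ultrafilter. A limit polynomial of degree k either has limiting bias 0
   or is a limit in measure of functions of polynomials of lower degree (Bogdanov-Viola).
   Limit polynomials Q_1, ..., Q_r of degree k that are independent modulo these limits are thus
   uniformly distributed and independent of all polynomials of lower degree, also on random cubes.
   So translating the values of the Q_i preserves the property of being almost everywhere a
   polynomial. As two polynomials that differ on a small set only are almost everywhere equal,
   a polynomial which is a limit of functions of polynomials of degree k involves only finitely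
   many of the Q_i; with their values fixed it is again a polynomial, now a limit of functions of
   polynomials of degree k - 1. By induction on k its measure is a dyadic rational, unlike 1/3. *)

(** * Averages over finite sets *)

Section Averages.
Variable R : realType.

Definition avg (T : finType) (h : T -> R) : R := #|T|%:R^-1 * \sum_x h x.

Definition sg (b : bool) : R := (-1) ^+ b.

Lemma sgD (a b : bool) : sg (a (+) b) = sg a * sg b.
Proof. exact: signr_addb. Qed.

Lemma sgE (b : bool) : sg b = 1 - 2 * b%:R.
Proof. by case: b; rewrite /sg ?expr1 ?expr0 /=; lra. Qed.

Lemma sgM (b : bool) : sg b * sg b = 1.
Proof. by case: b; rewrite /sg ?expr1 ?expr0 /=; lra. Qed.

Lemma norm_sg (b : bool) : `|sg b| = 1.
Proof. exact: normr_sign. Qed.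

Lemma avgD (T : finType) (g h : T -> R) :
  avg (fun x => g x + h x) = avg g + avg h.
Proof. by rewrite /avg big_split /= mulrDr. Qed.

Lemma avgZ (T : finType) (a : R) (h : T -> R) :
  avg (fun x => a * h x) = a * avg h.
Proof. by rewrite /avg -big_distrr /= mulrCA. Qed.

Lemma avgN (T : finType) (h : T -> R) : avg (fun x => - h x) = - avg h.
Proof. by rewrite /avg sumrN mulrN. Qed.

Lemma avgB (T : finType) (g h : T -> R) :
  avg (fun x => g x - h x) = avg g - avg h.
Proof. by rewrite avgD avgN. Qed.

Lemma avg_sum (T I : finType) (h : I -> T -> R) :
  avg (fun x => \sum_i h i x) = \sum_i avg (h i).
Proof. by rewrite /avg exchange_big /= big_distrr. Qed.

Lemma avg_ge0 (T : finType) (h : T -> R) : (forall x, 0 <= h x) -> 0 <= avg h.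
Proof. by move=> h0; rewrite mulr_ge0 ?invr_ge0 ?ler0n ?sumr_ge0. Qed.

Lemma ler_avg (T : finType) (g h : T -> R) :
  (forall x, g x <= h x) -> avg g <= avg h.
Proof. by move=> gh; rewrite ler_wpM2l ?invr_ge0 ?ler0n ?ler_sum. Qed.

Lemma ler_norm_avg (T : finType) (h : T -> R) : `|avg h| <= avg (fun x => `|h x|).
Proof.
rewrite /avg normrM ger0_norm ?invr_ge0 ?ler0n //.
by rewrite ler_wpM2l ?invr_ge0 ?ler0n ?ler_norm_sum.
Qed.

Lemma avg_exch (S T : finType) (h : S -> T -> R) :
  avg (fun x => avg (h x)) = avg (fun y => avg (fun x => h x y)).
Proof.
rewrite /avg -!big_distrr /= exchange_big /= !mulrA.
by rewrite [X in X * _]mulrC.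
Qed.

Lemma avg_bij (S T : finType) (f : S -> T) (h : T -> R) :
  bijective f -> avg (fun x => h (f x)) = avg h.
Proof.
by move=> bf; rewrite /avg (bij_eq_card bf) [in RHS](reindex f) //; apply: onW_bij.
Qed.

Lemma avg_pair (S T : finType) (h : S * T -> R) :
  avg h = avg (fun x => avg (fun y => h (x, y))).
Proof.
rewrite /avg card_prod natrM invfM -big_distrr /= pair_bigA /= mulrA.
by congr (_ * _); apply: eq_bigr => -[].
Qed.

Section NonEmpty.
Variables (T : finType) (x0 : T).

Lemma card_neq0 : #|T|%:R != 0 :> R.
Proof. by rewrite pnatr_eq0 -lt0n; apply/card_gt0P; exists x0. Qed.

Lemma avg_cst (a : R) : avg (fun _ : T => a) = a.
Proof. by rewrite /avg sumr_const -[a *+ _]mulr_natr mulrCA mulVf ?mulr1 // card_neq0. Qed.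

Lemma avg_le (h : T -> R) (a : R) : (forall x, h x <= a) -> avg h <= a.
Proof. by move=> ha; rewrite -[leRHS]avg_cst; apply: ler_avg. Qed.

Lemma avg_exists_le (h : T -> R) : exists x, h x <= avg h.
Proof.
apply: contrapT => /forallNP ne; have: avg h < avg h.
  rewrite -{1}[avg h]avg_cst /avg ltr_pM2l; last first.
    by rewrite invr_gt0 lt0r card_neq0 ler0n.
  apply: ltr_sum; first by apply/hasP; exists x0; rewrite // mem_index_enum.
  by move=> i _; rewrite ltNge; apply/negP/ne.
by rewrite ltxx.
Qed.

Lemma avg_exists_ge (h : T -> R) : exists x, avg h <= h x.
Proof.
have [x hx] := avg_exists_le (fun x => - h x).
by exists x; move: hx; rewrite avgN lerN2.
Qed.

Lemma avg_exists_norm (h : T -> R) : exists x, `|avg h| <= `|h x|.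
Proof.
have [x hx] := avg_exists_ge (fun x => `|h x|).
by exists x; apply: le_trans hx; apply: ler_norm_avg.
Qed.

End NonEmpty.

Lemma avg_sqr_le (T : finType) (x0 : T) (h : T -> R) :
  avg h ^+ 2 <= avg (fun x => h x ^+ 2).
Proof.
have: 0 <= avg (fun x => (h x - avg h) ^+ 2) by apply: avg_ge0 => x; apply: sqr_ge0.
under eq_fun do rewrite sqrrB -mulrnAr.
rewrite avgD avgB avg_cst //.
have -> : avg (fun x => h x * (avg h *+ 2)) = (avg h *+ 2) * avg h.
  by rewrite -avgZ; congr avg; apply/funext => x; rewrite mulrC.
set a := avg h; set b := avg _; rewrite mulr2n; nra.
Qed.

Lemma avg_shift (V : finZmodType) (s : V) (h : V -> R) :
  avg (fun x => h (x + s)) = avg h.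
Proof. by apply: (avg_bij h); exists (fun x => x - s) => x; rewrite ?addrK ?subrK. Qed.

Lemma avg_shiftl (V : finZmodType) (s : V) (h : V -> R) :
  avg (fun x => h (s + x)) = avg h.
Proof. by rewrite -(avg_shift s); congr avg; apply/funext => x; rewrite addrC. Qed.

(** Expanding the square, the terms with [i != j] factor over the coordinates and vanish because [g]
    is centred. This variance computation serves both the sampling of random directions and the
    concentration of Bernoulli bits. *)
Lemma sum_iid_sqr (T : finType) (w g : T -> R) (n : nat) (S : {set 'I_n}) :
  \sum_t w t = 1 -> \sum_t w t * g t = 0 ->
  \sum_(y : {ffun 'I_n -> T}) (\prod_i w (y i)) * (\sum_(i in S) g (y i)) ^+ 2
    = #|S|%:R * \sum_t w t * g t ^+ 2.
Proof.
move=> w1 wg0.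
have key (i j : 'I_n) :
  \sum_(y : {ffun 'I_n -> T}) (\prod_i w (y i)) * (g (y i) * g (y j)) =
    (i == j)%:R * \sum_t w t * g t ^+ 2.
  (* The weighted product [g (y i) * g (y j)] becomes a product over all coordinates, so that sum
     and product can be exchanged. *)
  pose F k t := w t * ((if k == i then g t else 1) * (if k == j then g t else 1)).
  transitivity (\sum_(y : {ffun 'I_n -> T}) \prod_k F k (y k)).
    apply: eq_bigr => y _; rewrite big_split big_split /=; congr (_ * (_ * _)).
      by rewrite -big_mkcond big_pred1_eq.
    by rewrite -big_mkcond big_pred1_eq.
  rewrite -bigA_distr_bigA /= (bigD1 i) //= /F eqxx.
  have [<-|ij] := eqVneq i j.
    rewrite [X in _ * X]big1 ?mulr1; last first.
      move=> k ki; rewrite (negbTE ki) -[RHS]w1; apply: eq_bigr => t _; ring.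
    by rewrite mul1r; apply: eq_bigr => t _; ring.
  rewrite mul0r; under eq_bigr do rewrite mulr1.
  by rewrite wg0 mul0r.
transitivity (\sum_(i in S) \sum_(j in S) (i == j)%:R * \sum_t w t * g t ^+ 2).
  under eq_bigr => y _.
    rewrite expr2 big_distrlr /= big_distrr /=.
    under eq_bigr do rewrite big_distrr /=.
    over.
  rewrite exchange_big /=; apply: eq_bigr => i _.
  by rewrite exchange_big /=; apply: eq_bigr => j _.
under eq_bigr => i iS.
  rewrite (bigD1 i) //= eqxx mul1r [X in _ + X]big1 ?addr0; last first.
    by move=> j /andP[_ ji]; rewrite eq_sym (negbTE ji) mul0r.
  over.
by rewrite sumr_const mulr_natl.
Qed.

Lemma sum_iid (T : finType) (w : T -> R) (n : nat) :
  \sum_t w t = 1 -> \sum_(y : {ffun 'I_n -> T}) \prod_i w (y i) = 1.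
Proof. by move=> w1; rewrite -(bigA_distr_bigA (fun=> w)) /= big1. Qed.

End Averages.

(** * Polynomials and random cubes *)

Section Derivatives.
Variable V : finZmodType.
Implicit Types (f g : V -> bool) (x y s : V).

Definition xorf f g : V -> bool := fun x => f x (+) g x.
Definition andf f g : V -> bool := fun x => f x && g x.
Definition shift s f : V -> bool := fun x => f (x + s).
Definition der y f : V -> bool := fun x => f (x + y) (+) f x.

Lemma xorfC f g : xorf f g = xorf g f.
Proof. by apply/funext => x; rewrite /xorf addbC. Qed.

Lemma xorfA f g h : xorf f (xorf g h) = xorf (xorf f g) h.
Proof. by apply/funext => x; rewrite /xorf addbA. Qed.

Lemma xorff f : xorf f f = fun=> false.
Proof. by apply/funext => x; rewrite /xorf addbb. Qed.

Lemma xorf0 f : xorf f (fun=> false) = f.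
Proof. by apply/funext => x; rewrite /xorf addbF. Qed.

Lemma xorfK f g : xorf f (xorf f g) = g.
Proof. by rewrite xorfA xorff xorfC xorf0. Qed.

Lemma der_xor y f g : der y (xorf f g) = xorf (der y f) (der y g).
Proof. by apply/funext => x; rewrite /der /xorf addbACA. Qed.

Lemma der_shift y s f : der y (shift s f) = shift s (der y f).
Proof. by apply/funext => x; rewrite /der /shift addrAC. Qed.

Lemma der_and y f g :
  der y (andf f g) = xorf (andf (der y f) (shift y g)) (andf f (der y g)).
Proof.
apply/funext => x; rewrite /der /andf /xorf /shift.
by case: (f x); case: (g x); case: (f _); case: (g _).
Qed.

(* Degree at most [k - 1]. *)
Fixpoint pdeg (k : nat) f : Prop :=
  if k is k'.+1 then forall y, pdeg k' (der y f) else forall x, f x = false.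

Lemma pdeg0 k : pdeg k (fun=> false).
Proof.
elim: k => [//|k IH] /= y.
by rewrite (_ : der y _ = fun=> false) //; apply/funext.
Qed.

Lemma pdeg_xor k f g : pdeg k f -> pdeg k g -> pdeg k (xorf f g).
Proof.
elim: k f g => [|k IH] f g /= pf pg; first by move=> x; rewrite /xorf pf pg.
by move=> y; rewrite der_xor; apply: IH.
Qed.

Lemma pdegS k f : pdeg k f -> pdeg k.+1 f.
Proof.
elim: k f => [|k IH] f pf.
  by move=> y x; rewrite /der !pf.
by move=> y; apply: IH; apply: pf.
Qed.

Lemma pdeg_leq k l f : (k <= l)%N -> pdeg k f -> pdeg l f.
Proof.
elim: l => [|l IH]; first by rewrite leqn0 => /eqP->.
by rewrite leq_eqVlt => /predU1P[->//|kl /(IH kl)/pdegS].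
Qed.

Lemma pdeg_shift k s f : pdeg k f -> pdeg k (shift s f).
Proof.
elim: k f => [|k IH] f /= pf; first by move=> x; rewrite /shift pf.
by move=> y; rewrite der_shift; apply: IH.
Qed.

Lemma pdeg_cst k b : pdeg k.+1 (fun=> b).
Proof.
move=> y; have -> : der y (fun=> b) = (fun=> false).
  by apply/funext => x; rewrite /der addbb.
exact: pdeg0.
Qed.

(** By the Leibniz rule [der_and] each derivative lowers one of the two parameters. For positive [k]
    and [l] the sum [k + l] is one above the sharp value, as [pdeg k] means degree at most
    [k - 1]. *)
Lemma pdeg_and k l f g : pdeg k f -> pdeg l g -> pdeg (k + l) (andf f g).
Proof.
elim: k l f g => [|k IHk] l f g.
  move=> f0 _; have -> : andf f g = fun=> false.
    by apply/funext => x; rewrite /andf f0.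
  exact: pdeg0.
elim: l g => [|l IHl] g pf pg.
  have -> : andf f g = fun=> false.
    by apply/funext => x; rewrite /andf pg andbF.
  exact: pdeg0.
rewrite addSn => y; rewrite der_and; apply: pdeg_xor.
  by apply: (IHk l.+1 _ _ (pf y)); apply: pdeg_shift.
by have := IHl _ pf (pg y); rewrite addSnnS.
Qed.

End Derivatives.

(** * Parity of Boolean functions on random cubes *)

Section CubeParity.
Variables (R : realType) (V : finZmodType).
Implicit Types (f g : V -> bool) (x y s : V).

Definition pr f : R := avg (fun x => (f x)%:R).
Definition bias f : R := avg (fun x => sg R (f x)).

Lemma biasE f : bias f = 1 - 2 * pr f.
Proof.
rewrite /bias /pr; under eq_fun do rewrite sgE.
by rewrite avgB avgZ (avg_cst (0 : V)).
Qed.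

Lemma pr_ge0 f : 0 <= pr f.
Proof. by apply: avg_ge0 => x; rewrite ler0n. Qed.

Lemma pr_le1 f : pr f <= 1.
Proof. by apply: (avg_le 0) => x; rewrite lern1 leq_b1. Qed.

Lemma pr_le f g : (forall x, f x -> g x) -> pr f <= pr g.
Proof.
by move=> fg; apply: ler_avg => x; rewrite ler_nat; case: (f x) (fg x) => // ->.
Qed.

Lemma pr_shift s f : pr (shift s f) = pr f.
Proof. exact: (avg_shift s (fun x => (f x)%:R)). Qed.

Lemma pr_xor_le f g : pr (xorf f g) <= pr f + pr g.
Proof.
rewrite -avgD; apply: ler_avg => x; rewrite /xorf -natrD ler_nat.
by case: (f x); case: (g x).
Qed.

Lemma pr_tri f g h : pr (xorf f h) <= pr (xorf f g) + pr (xorf g h).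
Proof.
by rewrite (_ : xorf f h = xorf (xorf f g) (xorf g h)) ?pr_xor_le // -xorfA xorfK.
Qed.

(* Probability that [f] has odd parity on a random cube [x + {0,1}^M y]. *)
Fixpoint oddcube (M : nat) f : R :=
  if M is M'.+1 then avg (fun y => oddcube M' (der y f)) else pr f.

Lemma oddcube_ge0 M f : 0 <= oddcube M f.
Proof. by elim: M f => [|M IH] f /=; [exact: pr_ge0|apply: avg_ge0]. Qed.

Lemma oddcube0 M f : pdeg M f -> oddcube M f = 0.
Proof.
elim: M f => [|M IH] f pf /=.
  by rewrite /pr; under eq_fun do rewrite pf; rewrite (avg_cst (0 : V)).
by under eq_fun do rewrite (IH _ (pf _)); rewrite (avg_cst (0 : V)).
Qed.

Lemma oddcube_xor M f g : oddcube M (xorf f g) <= oddcube M f + oddcube M g.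
Proof.
elim: M f g => [|M IH] f g /=; first exact: pr_xor_le.
by rewrite -avgD; apply: ler_avg => y; rewrite der_xor.
Qed.

Lemma oddcube_shift M s f : oddcube M (shift s f) = oddcube M f.
Proof.
elim: M f => [|M IH] f /=; first exact: pr_shift.
by congr avg; apply/funext => y; rewrite der_shift.
Qed.

(** A cube of dimension [M + 1] is the union of two parallel random [M]-cubes, one of which is odd
    whenever the union is. *)
Lemma oddcubeS_le M f : oddcube M.+1 f <= 2 * oddcube M f.
Proof.
rewrite /=; apply: (avg_le 0) => y.
have -> : der y f = xorf (shift y f) f by [].
by apply: le_trans (oddcube_xor _ _ _) _; rewrite oddcube_shift mulr_natl mulr2n.
Qed.

Lemma oddcube_addn_le M e f : oddcube (e + M) f <= 2 ^+ e * oddcube M f.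
Proof.
elim: e => [|e IH]; first by rewrite mul1r.
rewrite addSn; apply: le_trans (oddcubeS_le _ _) _.
by rewrite exprS -mulrA ler_pM2l.
Qed.

Lemma oddcube_le_pr M f : oddcube M f <= 2 ^+ M * pr f.
Proof. by rewrite -[M in oddcube M]addn0; apply: oddcube_addn_le. Qed.

(* If a cube has one vertex in a small set then most likely it has only one. *)
Lemma oddcube_sep M f : pr f * (1 - 2 ^+ M * pr f) <= oddcube M f.
Proof.
elim: M f => [|M IH] f /=.
  have := pr_ge0 f; rewrite expr0 mul1r; set a := pr f => a0.
  by nra.
set a := pr f.
(* If [2 ^+ M.+1 * a >= 1] the lower bound is nonpositive. *)
have [a1|a1] := leP 1 (2 ^+ M.+1 * a).
  apply: le_trans (avg_ge0 _); last by move=> y; exact: oddcube_ge0.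
  by have := pr_ge0 f; rewrite -/a; nra.
apply: le_trans (ler_avg (fun y => IH (der y f))).
have hy y : pr (der y f) <= 2 * a.
  have -> : der y f = xorf (shift y f) f by [].
  by apply: le_trans (pr_xor_le _ _) _; rewrite pr_shift /a; lra.
(* The points [x] and [x + y] are independent, so exactly one of them lies in [f] with probability
   [2 a (1 - a)], which is at least [a] when [a <= 1/2]. *)
have avgder : avg (fun y => pr (der y f)) = 2 * a * (1 - a).
  rewrite /pr avg_exch.
  have -> : (fun x : V => avg (fun y : V => (der y f x)%:R)) =
            (fun x : V => a + (f x)%:R * (1 - 2 * a)).
    apply/funext => x; rewrite /der.
    have -> : (fun y : V => (f (x + y) (+) f x)%:R) =
              (fun y : V => (f x)%:R + (1 - 2 * (f x)%:R) * (f (x + y))%:R) :> (V -> R).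
      by apply/funext => y; case: (f x); case: (f _) => /=; lra.
    rewrite avgD avgZ (avg_cst (0 : V)) (avg_shiftl x (fun y => (f y)%:R)) -/(pr f) -/a.
    by case: (f x) => /=; lra.
  rewrite avgD (avg_cst (0 : V)).
  under eq_fun do rewrite mulrC.
  by rewrite avgZ -/(pr f) -/a; ring.
have c0 : 0 < 2 ^+ M :> R by rewrite exprn_gt0.
have : (1 - 2 ^+ M.+1 * a) * (2 * a * (1 - a)) <=
       avg (fun y => pr (der y f) * (1 - 2 ^+ M * pr (der y f))).
  rewrite -avgder -avgZ; apply: ler_avg => y.
  rewrite mulrC ler_wpM2l ?pr_ge0 // exprS.
  by have := hy y; nra.
apply: le_trans.
have : 1 <= 2 ^+ M :> R by rewrite exprn_ege1 // ler1n.
have := pr_ge0 f; rewrite -/a; rewrite exprS in a1 *; set c := 2 ^+ M in a1 c0 *.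
move=> a0 c1; have a2 : 2 * a <= 1 by nra.
have : 0 <= (1 - 2 * c * a) * (a * (1 - 2 * a)) by apply: mulr_ge0; nra.
by nra.
Qed.

(** A robust version of [pdeg_and], where [f] is only almost a polynomial. By the Leibniz rule each
    derivative falls on [f], lowering [M], or on [g], lowering [e]; this explains the double
    induction and the doubling of the constant. *)
Lemma oddcube_and M e f g :
  pdeg e g -> oddcube (M + e) (andf f g) <= 2 ^+ (M + e) * oddcube M f.
Proof.
elim: M e f g => [|M IHM] e f g.
  move=> _; rewrite add0n -[e in oddcube e]addn0.
  apply: le_trans (oddcube_addn_le _ _ _) _; rewrite ler_wpM2l ?exprn_ge0 //.
  by apply: pr_le => x /andP[].
elim: e g => [|e IHe] g pg.
  have -> : andf f g = fun=> false.
    by apply/funext => x; rewrite /andf pg andbF.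
  rewrite oddcube0; last exact: pdeg0.
  by rewrite mulr_ge0 ?exprn_ge0 ?oddcube_ge0.
rewrite addnS.
have step y : oddcube (M.+1 + e) (der y (andf f g)) <=
    2 ^+ (M.+1 + e) * oddcube M (der y f) + 2 ^+ (M.+1 + e) * oddcube M.+1 f.
  rewrite der_and; apply: le_trans (oddcube_xor _ _ _) _.
  apply: lerD; last exact: IHe (pg y).
  by have := IHM e.+1 (der y f) (shift y g) (pdeg_shift y pg); rewrite addnS -addSn.
change (avg (fun y => oddcube (M.+1 + e) (der y (andf f g))) <=
        2 ^+ (M.+1 + e).+1 * oddcube M.+1 f).
apply: le_trans (ler_avg step) _.
rewrite avgD avgZ (avg_cst (0 : V)) exprS -mulrA.
by rewrite mulr_natl mulr2n.
Qed.

End CubeParity.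

(** * Cube averages of real functions *)

Section Cubes.
Variables (R : realType) (m : nat).
Local Notation V := 'rV['F_2]_m.

(** For [M > 0] this is the [2^M]-th power of the Gowers norm of order [M]; the recursion runs
    parallel to that of [oddcube]. *)
Fixpoint cubeavg (M : nat) (h : V -> R) : R :=
  if M is M'.+1 then avg (fun y => cubeavg M' (fun x => h x * h (x + y))) else avg h.

Lemma cubeavg_sg M (f : V -> bool) : cubeavg M (fun x => sg R (f x)) = 1 - 2 * oddcube R M f.
Proof.
elim: M f => [|M IH] f /=; first exact: biasE.
have -> : (fun y => cubeavg M (fun x => sg R (f x) * sg R (f (x + y)))) =
          (fun y => 1 - 2 * oddcube R M (der y f)).
  apply/funext => y; rewrite -IH; congr cubeavg; apply/funext => x.
  by rewrite /der sgD mulrC.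
by rewrite avgB avgZ (avg_cst (0 : V)).
Qed.

Lemma prod_rV1 (n : nat) (h : 'rV['F_2]_n.+1 -> R) :
  \prod_v h v =
  \prod_(v : 'rV['F_2]_n) (h (row_mx (0 : 'M['F_2]_1) v) * h (row_mx (1%:M : 'M['F_2]_1) v)).
Proof.
have bij2 : bijective (fun p : 'F_2 * 'rV['F_2]_n => row_mx p.1%:M p.2 : 'rV_(1 + n)).
  exists (fun v => (lsubmx v 0 0, rsubmx v)) => [[a v]|v] /=.
    by rewrite row_mxKl row_mxKr mxE eqxx.
  by rewrite -mx11_scalar hsubmxK.
rewrite (reindex (fun p : 'F_2 * 'rV['F_2]_n => row_mx p.1%:M p.2 : 'rV_(1 + n))) /=;
  last exact: onW_bij.
rewrite -(pair_bigA _ (fun a v => h (row_mx a%:M v))) /=.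
rewrite (bigD1 (0 : 'F_2)) //= (bigD1 (1 : 'F_2)) //= [X in _ * (_ * X)]big1.
  by rewrite mulr1 -big_split /= raddf0.
by move=> [[|[|k]] hk] //=.
Qed.

Lemma avg_mxS (n : nat) (h : 'M['F_2]_(n.+1, m) -> R) :
  avg h = avg (fun y : V => avg (fun Y : 'M['F_2]_(n, m) => h (col_mx y Y))).
Proof.
rewrite -(avg_pair (fun p : V * 'M['F_2]_(n, m) => h (col_mx p.1 p.2))).
rewrite (avg_bij (f := fun p : V * 'M['F_2]_(n, m) => col_mx p.1 p.2 : 'M['F_2]_(1 + n, m)) h) //.
exists (fun Y => (usubmx Y, dsubmx Y)) => [[y Y]|Y] /=.
  by rewrite col_mxKu col_mxKd.
by rewrite vsubmxK.
Qed.

Lemma cubeavgE M (h : V -> R) :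
  cubeavg M h = avg (fun Y : 'M['F_2]_(M, m) => avg (fun x => \prod_(v : 'rV_M) h (x + v *m Y))).
Proof.
elim: M h => [|M IH] h /=.
  have -> : (fun Y : 'M['F_2]_(0, m) => avg (fun x => \prod_(v : 'rV_0) h (x + v *m Y))) =
            (fun=> avg h).
    apply/funext => Y; congr avg; apply/funext => x.
    rewrite (big_pred1 0); last by move=> v /=; rewrite thinmx0 eqxx.
    by rewrite mul0mx addr0.
  by rewrite (avg_cst (0 : 'M['F_2]_(0, m))).
rewrite avg_mxS; congr avg; apply/funext => y; rewrite IH.
congr avg; apply/funext => Y; congr avg; apply/funext => x.
rewrite prod_rV1; apply: eq_bigr => v _.
have -> : row_mx (0 : 'M['F_2]_1) v *m col_mx y Y = v *m Y.
  by rewrite (@mul_row_col _ _ 1 M) mul0mx add0r.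
have -> : row_mx (1%:M : 'M['F_2]_1) v *m col_mx y Y = v *m Y + y.
  by rewrite (@mul_row_col _ _ 1 M) mul1mx addrC.
by rewrite addrA.
Qed.

Lemma avg_exp_le (T : finType) (x0 : T) (g : T -> R) M :
  (forall x, 0 <= g x) -> avg g ^+ (2 ^ M) <= avg (fun x => g x ^+ (2 ^ M)).
Proof.
move=> g0; elim: M => [|M IH]; first by rewrite expn0.
rewrite expnSr exprM; under [X in _ <= avg X]eq_fun do rewrite exprM.
apply: le_trans (avg_sqr_le x0 _).
by rewrite ler_pXn2r // ?nnegrE ?exprn_ge0 ?avg_ge0 // => x; rewrite exprn_ge0.
Qed.

(** Induction applies to [h x * h (x + y)] for every [y]; the mean over [y] of the averages of these
    products is [avg h ^+ 2], and Jensen's inequality concludes. For an indicator function this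
    bounds from below the probability that a random cube lies inside a dense set. *)
Lemma cubeavg_ge M (h : V -> R) : (forall x, 0 <= h x) -> avg h ^+ (2 ^ M) <= cubeavg M h.
Proof.
elim: M h => [|M IH] h h0 /=; first by rewrite expn0.
apply: (@le_trans _ _ (avg (fun y => avg (fun x => h x * h (x + y)) ^+ (2 ^ M)))); last first.
  by apply: ler_avg => y; apply: IH => x; rewrite mulr_ge0.
apply: le_trans (avg_exp_le (0 : V) M _); last first.
  by move=> y; apply: avg_ge0 => x; rewrite mulr_ge0.
rewrite avg_exch.
have -> : (fun x : V => avg (fun y => h x * h (x + y))) = (fun x => avg h * h x).
  by apply/funext => x; rewrite avgZ avg_shiftl mulrC.
by rewrite avgZ -expr2 -exprM -expnS.
Qed.

(** Some entry of [w] is 1, so translating the corresponding row of [Y] by [z] translates [w *m Y]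
    by [z]; averaging over [z] shows that [w *m Y] is uniform. *)
Lemma avg_mx_row M (w : 'rV['F_2]_M) (g : V -> R) :
  w != 0 -> avg (fun Y : 'M['F_2]_(M, m) => g (w *m Y)) = avg g.
Proof.
move=> /rV0Pn[i wi].
have w1 : w 0 i = 1 by move: wi; case: (w 0 i) => -[|[|k]] hk // _; apply/val_inj.
rewrite -[RHS](avg_cst (0 : 'M['F_2]_(M, m))).
have sh (z : V) : avg (fun Y : 'M['F_2]_(M, m) => g (w *m Y)) =
                  avg (fun Y : 'M['F_2]_(M, m) => g (w *m Y + z)).
  rewrite -(avg_shift (delta_mx i 0 *m z)); congr avg; apply/funext => Y.
  rewrite mulmxDr mulmxA -colE; congr (g (_ + _)).
  have -> : col i w = 1%:M by apply/matrixP => a b; rewrite !mxE !ord1 w1.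
  by rewrite mul1mx.
transitivity (avg (fun z : V => avg (fun Y : 'M['F_2]_(M, m) => g (w *m Y + z)))).
  rewrite -[LHS](avg_cst (0 : V)); congr avg; apply/funext => z; exact: sh.
rewrite [LHS]avg_exch; congr avg; apply/funext => Y; exact: (avg_shiftl (w *m Y) g).
Qed.

(** Distinct vertices of a random cube are independent: after moving the first one to [x], their
    difference is [(v' - v) *m Y], which is uniform. *)
Lemma avg_cube_pair M (v v' : 'rV['F_2]_M) (g : V -> V -> R) : v != v' ->
  avg (fun Y : 'M['F_2]_(M, m) => avg (fun x => g (x + v *m Y) (x + v' *m Y))) =
  avg (fun x => avg (g x)).
Proof.
move=> vv'.
have -> : (fun Y : 'M['F_2]_(M, m) => avg (fun x => g (x + v *m Y) (x + v' *m Y))) =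
          (fun Y => avg (fun x => g x (x + (v' - v) *m Y))).
  apply/funext => Y; rewrite -[RHS](avg_shift (v *m Y)); congr avg; apply/funext => x.
  by rewrite mulmxBl -!addrA; congr (g _ (_ + _)); rewrite addrC subrK.
rewrite [LHS]avg_exch; congr avg; apply/funext => x.
by rewrite (avg_mx_row (fun z => g x (x + z))) ?(avg_shiftl x (g x)) // subr_eq0 eq_sym.
Qed.

End Cubes.

(** * Families of polynomials with a prescribed mean *)

Section Ramsey.
Variable C : finType.

Lemma pigeonhole (c0 : C) (T : Type) (f : T -> C) (l : seq T) s :
  (#|C| * s <= size l)%N -> exists c, (s <= size [seq x <- l | f x == c])%N.
Proof.
move=> sl; apply: contrapT => /forallNP H.
have szE : size l = (\sum_c size [seq x <- l | f x == c])%N.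
  elim: l {sl H} => [|x l IH]; first by rewrite /= big1.
  rewrite /= IH (bigD1 (f x)) //= [in RHS](bigD1 (f x)) //= eqxx /= addSn.
  by congr (_ + _).+1; apply: eq_bigr => c /negbTE; rewrite eq_sym => ->.
case: s sl H => [|s] sl H; first by have := H c0.
have : (size l <= #|C| * s)%N.
  rewrite szE -sum_nat_const; apply: leq_sum => c _.
  by have := H c; case: ltnP.
move=> /(leq_trans sl); rewrite leq_mul2l ltnn orbF => /eqP C0.
by have := fintype0 c0 C0.
Qed.

(** Greedy choice: keep the head of the list, restrict the tail to a large colour class seen from
    that head, and record its colour. Each pair then has the colour recorded at its first member,
    and one more pigeonhole argument gives [ramsey]. *)
Lemma ramsey_end (c0 : C) t : exists N, forall (T : eqType) (chi : T -> T -> C) (l : seq T),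
  (N <= size l)%N -> exists l' : seq (T * C),
    [/\ subseq (map fst l') l, size l' = t & pairwise (fun p q => chi p.1 q.1 == p.2) l'].
Proof.
elim: t => [|t [N IH]]; first by exists 0%N => T chi l _; exists [::]; rewrite /= sub0seq.
exists (#|C| * N).+1 => T chi [//|v l]; rewrite /= ltnS => /(pigeonhole c0 (chi v))[c hc].
have [l' [sub sz pw]] := IH T chi _ hc; exists ((v, c) :: l'); split => /=.
- by rewrite eqxx (subseq_trans sub) // filter_subseq.
- by rewrite sz.
- rewrite pw andbT; apply/allP => p pl' /=.
  have : p.1 \in [seq x <- l | chi v x == c] by apply: (mem_subseq sub); exact: map_f.
  by rewrite mem_filter => /andP[].
Qed.

Lemma ramsey (c0 : C) s : exists N, forall (T : eqType) (chi : T -> T -> C) (l : seq T),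
  (N <= size l)%N -> exists c (l' : seq T),
    [/\ subseq l' l, size l' = s & pairwise (fun a b => chi a b == c) l'].
Proof.
have [N H] := ramsey_end c0 (#|C| * s); exists N => T chi l /(H T chi)[l' [sub sz pw]].
have [c hc] : exists c, (s <= size [seq p <- l' | p.2 == c])%N.
  by apply: pigeonhole; rewrite ?sz.
pose l2 := take s [seq p <- l' | p.2 == c].
have sub2 : subseq l2 l' by rewrite (subseq_trans (take_subseq _ _)) // filter_subseq.
exists c, (map fst l2); split.
- by rewrite (subseq_trans (map_subseq _ sub2)).
- by rewrite size_map size_take_min; apply/minn_idPl.
- rewrite pairwise_map; have pw2 := subseq_pairwise sub2 pw.
  have al : all (fun p => p.2 == c) l2.
    by apply/allP => p /mem_take; rewrite mem_filter => /andP[].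
  elim: l2 {sub2} al pw2 => //= p l2 IH /andP[/eqP pc al] /andP[h pw2].
  by rewrite IH // andbT; rewrite -pc; exact: h.
Qed.

End Ramsey.

(** * Empirical covariances of families with nearly equal correlations *)

Section SecondMoment.
Variable R : realType.

Lemma avg_sqrE (T : finType) (h : T -> R) : avg h ^+ 2 = avg (fun x => avg (fun y => h x * h y)).
Proof.
rewrite expr2 -avgZ; congr avg; apply/funext => x; rewrite avgZ mulrC //.
Qed.

(** Both sides are the mean of [g a x * g a y * g b x * g b y] over [a], [b], [x] and [y]. *)
Lemma avg_cov_sqr (I T : finType) (g : I -> T -> R) :
  avg (fun x => avg (fun y => avg (fun a => g a x * g a y) ^+ 2)) =
  avg (fun a => avg (fun b => avg (fun x => g a x * g b x) ^+ 2)).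
Proof.
transitivity (avg (fun x => avg (fun y => avg (fun a => avg (fun b =>
   (g a x * g b x) * (g a y * g b y)))))).
  congr avg; apply/funext => x; congr avg; apply/funext => y.
  rewrite avg_sqrE; congr avg; apply/funext => a; congr avg; apply/funext => b; ring.
transitivity (avg (fun a => avg (fun b => avg (fun x => avg (fun y =>
   (g a x * g b x) * (g a y * g b y)))))); last first.
  by congr avg; apply/funext => a; congr avg; apply/funext => b; rewrite avg_sqrE.
transitivity (avg (fun x => avg (fun a => avg (fun y => avg (fun b =>
   (g a x * g b x) * (g a y * g b y)))))).
  by congr avg; apply/funext => x; rewrite [LHS]avg_exch.
rewrite [LHS]avg_exch; congr avg; apply/funext => a.
transitivity (avg (fun x => avg (fun b => avg (fun y =>
   (g a x * g b x) * (g a y * g b y))))).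
  by congr avg; apply/funext => x; rewrite [LHS]avg_exch.
by rewrite [LHS]avg_exch.
Qed.

(* [avg_a F_a(x) F_a(y) - b(x) b(y)] is an empirical covariance, so its mean square is that of
   the doubly centred Gram matrix of the [F_a]. *)
Lemma cov_small (s : nat) (T : finType) (x0 : T) (F : 'I_s.+1 -> T -> R) (be d : R) :
  (forall a x, F a x * F a x = 1) -> `|be| <= 1 ->
  (forall a b, a != b -> `|avg (fun x => F a x * F b x) - be| <= d) ->
  avg (fun x => avg (fun y => (avg (fun a => F a x * F a y) -
     avg (fun a => F a x) * avg (fun a => F a y)) ^+ 2)) <= 16 * (d ^+ 2 + 4 / s.+1%:R).
Proof.
move=> F1 be1 Fd.
pose b x := avg (fun a => F a x).
pose g a x := F a x - b x.
pose e a a' := avg (fun x => F a x * F a' x) - be.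
have i0 : 'I_s.+1 := ord0.
have covE x y : avg (fun a => F a x * F a y) - b x * b y = avg (fun a => g a x * g a y).
  have -> : (fun a => g a x * g a y) =
      (fun a => F a x * F a y - b y * F a x - (b x * F a y - b x * b y)).
    by apply/funext => a; rewrite /g; ring.
  rewrite [RHS]avgB [X in _ = X - _]avgB [X in _ = _ - X]avgB.
  by rewrite (avg_cst i0 (b x * b y)) !avgZ -/(b x) -/(b y); ring.
under eq_fun do under eq_fun do rewrite covE.
rewrite avg_cov_sqr.
pose r a := avg (e a). pose t := avg r.
(* The common correlation [be] cancels under the double centring; only the deviations [e]
   survive. *)
have gE a a' : avg (fun x => g a x * g a' x) = e a a' - r a - r a' + t.
  have Fb a1 : avg (fun x => F a1 x * b x) = r a1 + be.
    have -> : (fun x => F a1 x * b x) = (fun x => avg (fun a2 => F a1 x * F a2 x)).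
      by apply/funext => x; rewrite avgZ.
    rewrite avg_exch /r /e avgB (avg_cst i0); ring.
  have bb : avg (fun x => b x * b x) = t + be.
    have -> : (fun x => b x * b x) = (fun x => avg (fun a2 => F a2 x * b x)).
      apply/funext => x; rewrite -[LHS]avgZ; congr avg; apply/funext => a2; exact: mulrC.
    rewrite avg_exch; have -> : (fun a2 => avg (fun x => F a2 x * b x)) = (fun a2 => r a2 + be).
      by apply/funext.
    by rewrite avgD (avg_cst i0).
  have -> : (fun x => g a x * g a' x) =
      (fun x => F a x * F a' x - F a x * b x - (F a' x * b x - b x * b x)).
    by apply/funext => x; rewrite /g; ring.
  by rewrite !avgB !Fb bb /e; ring.
pose S := avg (fun a => avg (fun a' => e a a' ^+ 2)).
have S_le : S <= d ^+ 2 + 4 / s.+1%:R.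
  have d0 : 0 <= d ^+ 2 by apply: sqr_ge0.
  apply: (avg_le i0) => a.
  (* Off the diagonal [e] is at most [d]. On it [e a a = 1 - be] is at most 2, and the diagonal is a
     fraction [1 / s.+1] of all pairs. *)
  apply: (@le_trans _ _ (avg (fun a' : 'I_s.+1 => d ^+ 2 + 4 * (a' == a)%:R))).
    apply: ler_avg => a'; have [->|ne] := eqVneq a' a.
      have -> : e a a = 1 - be.
        by rewrite /e; under eq_fun do rewrite F1; rewrite (avg_cst x0).
      by move: be1; rewrite ler_norml => /andP[h1 h2]; rewrite mulr1; nra.
    rewrite mulr0 addr0 -[_ ^+ 2]ger0_norm ?sqr_ge0 // normrX.
    have ed := Fd a a' _; rewrite eq_sym in ed; have {}ed := ed ne.
    by rewrite -[d ^+ 2]/(d ^+ 2) lerXn2r // ?nnegrE //; apply: le_trans ed.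
  rewrite avgD (avg_cst i0) avgZ /avg card_ord (bigD1 a) //= eqxx big1 ?addr0 ?mulr1 //.
  by move=> i /negbTE->.
have r_le : avg (fun a => r a ^+ 2) <= S by apply: ler_avg => a; apply: (avg_sqr_le i0).
have t_le : t ^+ 2 <= S by apply: le_trans r_le; apply: (avg_sqr_le i0).
apply: (@le_trans _ _ (16 * S)); last by rewrite ler_pM2l.
apply: (@le_trans _ _ (avg (fun a => avg (fun a' =>
   4 * e a a' ^+ 2 + 4 * r a ^+ 2 + (4 * r a' ^+ 2 + 4 * t ^+ 2))))).
  apply: ler_avg => a; apply: ler_avg => a'; rewrite gE.
  set p := e a a'; set q := r a; set w := r a'.
  have h1 := sqr_ge0 (p + q); have h2 := sqr_ge0 (p + w); have h3 := sqr_ge0 (p - t).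
  have h4 := sqr_ge0 (q - w); have h5 := sqr_ge0 (q + t); have h6 := sqr_ge0 (w + t).
  nra.
have lin (A B : 'I_s.+1 -> R) K :
    avg (fun a => 4 * A a + 4 * B a + K) = 4 * avg A + 4 * avg B + K.
  by rewrite avgD (avg_cst i0) avgD avgZ avgZ.
have -> : (fun a => avg (fun a' => 4 * e a a' ^+ 2 + 4 * r a ^+ 2 + (4 * r a' ^+ 2 + 4 * t ^+ 2))) =
  (fun a => 4 * avg (fun a' => e a a' ^+ 2) + 4 * r a ^+ 2 +
    (4 * avg (fun a => r a ^+ 2) + 4 * t ^+ 2)).
  apply/funext => a.
  have -> : (fun a' => 4 * e a a' ^+ 2 + 4 * r a ^+ 2 + (4 * r a' ^+ 2 + 4 * t ^+ 2)) =
            (fun a' => 4 * e a a' ^+ 2 + 4 * r a' ^+ 2 + (4 * r a ^+ 2 + 4 * t ^+ 2)).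
    by apply/funext => a'; ring.
  by rewrite lin; ring.
by rewrite lin -/S; lra.
Qed.

End SecondMoment.

(** * Empirical means of families of polynomials *)

Section Families.
Variable R : realType.

Lemma pdeg_cube m k K (f : 'rV['F_2]_m -> bool) (Y : 'M['F_2]_(k, m)) x :
  pdeg K f -> pdeg K (fun v : 'rV_k => f (x + v *m Y)).
Proof.
elim: K f => [|K IH] f pf; first by move=> v; apply: pf.
move=> w; have -> : der w (fun v : 'rV_k => f (x + v *m Y)) =
    (fun v : 'rV_k => der (w *m Y) f (x + v *m Y)).
  by apply/funext => v; rewrite /der mulmxDl addrA.
exact: IH (pf _).
Qed.

(** First moment method: a random cube lies in [A] with probability at least [rho], while the
    expectation of [off] is at most [ka] because distinct vertices are independent. Hence
    [2 * ka * ind - rho * off] has positive mean, and any cube where it is positive will do. *)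
Lemma cube_search m k (A : 'rV['F_2]_m -> bool) (D : 'rV['F_2]_m -> 'rV['F_2]_m -> R) (al ka : R) :
  0 < al -> al <= pr R A -> 0 < ka -> (forall x y, 0 <= D x y) ->
  avg (fun x => avg (D x)) <= ka ->
  exists (Y : 'M['F_2]_(k, m)) x, (forall v, A (x + v *m Y)) /\
    avg (fun v : 'rV_k => avg (fun w : 'rV_k => (v != w)%:R * D (x + v *m Y) (x + w *m Y)))
      <= 2 * ka / al ^+ (2 ^ k).
Proof.
move=> al0 alA ka0 D0 Dka; set rho := al ^+ (2 ^ k).
have rho0 : 0 < rho by rewrite exprn_gt0.
pose ind (Y : 'M['F_2]_(k, m)) (x : 'rV['F_2]_m) : R := \prod_(v : 'rV_k) (A (x + v *m Y))%:R.
pose off (Y : 'M['F_2]_(k, m)) (x : 'rV['F_2]_m) : R :=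
  avg (fun v : 'rV_k => avg (fun w : 'rV_k => (v != w)%:R * D (x + v *m Y) (x + w *m Y))).
have off0 Y x : 0 <= off Y x.
  by apply: avg_ge0 => v; apply: avg_ge0 => w; rewrite mulr_ge0 ?ler0n.
have indE : rho <= avg (fun Y : 'M['F_2]_(k, m) => avg (ind Y)).
  rewrite /ind -(cubeavgE k (fun x => (A x)%:R)).
  apply: le_trans (cubeavg_ge k _); last by move=> x; rewrite ler0n.
  by rewrite lerXn2r // nnegrE ?pr_ge0 // ltW.
have offE : avg (fun Y : 'M['F_2]_(k, m) => avg (off Y)) <= ka.
  rewrite /off.
  have -> : (fun Y : 'M['F_2]_(k, m) => avg (fun x => avg (fun v : 'rV_k => avg (fun w : 'rV_k =>
      (v != w)%:R * D (x + v *m Y) (x + w *m Y))))) =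
    (fun Y => avg (fun v : 'rV_k => avg (fun w : 'rV_k => avg (fun x =>
      (v != w)%:R * D (x + v *m Y) (x + w *m Y))))).
    apply/funext => Y; rewrite [LHS]avg_exch; congr avg; apply/funext => v.
    by rewrite [LHS]avg_exch.
  rewrite avg_exch; apply: (avg_le (0 : 'rV_k)) => v.
  rewrite avg_exch; apply: (avg_le (0 : 'rV_k)) => w.
  have [_|vw] := eqVneq v w.
    under eq_fun do under eq_fun do rewrite mul0r.
    by rewrite (avg_cst (0 : 'rV_m)) (avg_cst (0 : 'M['F_2]_(k, m))) ltW.
  under eq_fun do under eq_fun do rewrite mul1r.
  by rewrite (avg_cube_pair D vw).
have [Y hY] := avg_exists_ge (0 : 'M['F_2]_(k, m))
  (fun Y : 'M['F_2]_(k, m) => avg (fun x => 2 * ka * ind Y x - rho * off Y x)).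
have [x hx] := avg_exists_ge (0 : 'rV['F_2]_m) (fun x => 2 * ka * ind Y x - rho * off Y x).
have pos : 0 < 2 * ka * ind Y x - rho * off Y x.
  apply: lt_le_trans (le_trans hY hx).
  have -> : (fun Y : 'M['F_2]_(k, m) => avg (fun x => 2 * ka * ind Y x - rho * off Y x)) =
            (fun Y => 2 * ka * avg (ind Y) - rho * avg (off Y)).
    by apply/funext => Z; rewrite avgB; congr (_ - _); exact: avgZ.
  rewrite avgB [X in X - _]avgZ [X in _ - X]avgZ.
  by nra.
have Av v : A (x + v *m Y).
  apply/negPn/negP => nA; have i0 : ind Y x = 0.
    by rewrite /ind (bigD1 v) //= (negbTE nA) mul0r.
  by move: pos; rewrite i0 mulr0 sub0r oppr_gt0 pmulr_rlt0 // ltNge off0.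
exists Y, x; split => //; rewrite -/(off Y x) ler_pdivlMr // mulrC.
have i1 : ind Y x = 1 by rewrite /ind big1 // => v _; rewrite Av.
by move: pos; rewrite i1; lra.
Qed.

(** If the event had probability above [ep], [cube_search] would provide a cube inside it whose
    pairs of vertices nearly factorise. The squared distance to 1/3 of the bias of [P a] on that
    cube, averaged over [a], would then be small, contradicting the gap for some restricted
    [P a]. *)
Lemma family_bound K (d ep : R) : 0 < d -> 0 < ep ->
  (forall m (f : 'rV['F_2]_m -> bool), pdeg K f -> d <= `|bias R f - 3^-1|) ->
  exists s (de de' : R), [/\ 0 < de, 0 < de', (s.+1%:R * de' ^+ 2)^-1 <= ep &
    forall m (P : 'I_s.+1 -> 'rV['F_2]_m -> bool) be, (forall a, pdeg K (P a)) -> `|be| <= 1 ->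
      (forall a b, a != b -> `|avg (fun x => sg R (P a x) * sg R (P b x)) - be| <= de) ->
      pr R (fun x => `|avg (fun a => sg R (P a x)) - 3^-1| <= de') <= ep].
Proof.
move=> d0 ep0 gap.
have [k hk] : exists k, 2^-1 ^+ k <= d ^+ 2 / 8.
  have e0 : 0 < d ^+ 2 / 8 by rewrite divr_gt0 // exprn_gt0.
  exists (Num.truncn (d ^+ 2 / 8)^-1).+1; rewrite exprVn invf_ple ?posrE ?exprn_gt0 //.
  rewrite (le_trans (ltW (truncnS_gt _))) // -natrX ler_nat.
  exact/ltnW/ltn_expl.
(* The squared deviation of the bias receives at most [d^2 / 8] from the diagonal of the cube,
   [2 tau = d^2 / 4] from covariances and [de'^2 = d^2 / 9] from the event, in total less than
   [d^2]. The choice of [ka] turns the bound [2 * ka / rho] of [cube_search] into [tau^2]. *)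
pose tau := d ^+ 2 / 8; have tau0 : 0 < tau by rewrite divr_gt0 // exprn_gt0.
pose rho := ep ^+ (2 ^ k); have rho0 : 0 < rho by rewrite exprn_gt0.
pose ka := tau * rho * tau / 2; have ka0 : 0 < ka by rewrite !mulr_gt0 ?invr_gt0.
pose de := Num.min 1 (ka / 32); pose de' := d / 3.
have de0 : 0 < de by rewrite lt_min ltr01 divr_gt0.
have de'0 : 0 < de' by rewrite divr_gt0.
have de2 : de ^+ 2 <= ka / 32.
  have h1 : de <= 1 by rewrite /de ge_min lexx.
  have h2 : de <= ka / 32 by rewrite /de ge_min lexx orbT.
  by nra.
(* The first bound, together with [de^2 <= ka / 32], makes [cov_small] yield [ka]; the second one is
   for Chebyshev's inequality on the Bernoulli side. *)
pose s := Num.truncn (Num.max (128 / ka) ((ep * de' ^+ 2)^-1)).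
have hs : Num.max (128 / ka) ((ep * de' ^+ 2)^-1) <= s.+1%:R by rewrite ltW // truncnS_gt.
have s1 : 128 / ka <= s.+1%:R by apply: le_trans hs; rewrite le_max lexx.
have s2 : (ep * de' ^+ 2)^-1 <= s.+1%:R by apply: le_trans hs; rewrite le_max lexx orbT.
have sn0 : 0 < s.+1%:R :> R by rewrite ltr0Sn.
clearbody s de.
exists s, de, de'; split => //.
  have p0 : 0 < de' ^+ 2 by rewrite exprn_gt0.
  have ep2 : 0 < ep * de' ^+ 2 by exact: mulr_gt0.
  have sp2 : 0 < s.+1%:R * de' ^+ 2 by exact: mulr_gt0.
  move: s2; rewrite -[(ep * _)^-1]mul1r ler_pdivrMr // => s2.
  rewrite -[leLHS]mul1r ler_pdivrMr //.
  by have -> : ep * (s.+1%:R * de' ^+ 2) = s.+1%:R * (ep * de' ^+ 2) by ring.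
move=> m P be PK be1 Pbe; rewrite leNgt; apply/negP => epA.
set A := fun x => _ in epA.
pose F a x := sg R (P a x).
pose D x y := (avg (fun a => F a x * F a y) - avg (fun a => F a x) * avg (fun a => F a y)) ^+ 2.
have Dka : avg (fun x => avg (D x)) <= ka.
  apply: le_trans (cov_small (0 : 'rV_m) (F := F) (fun a x => sgM R (P a x)) be1 Pbe) _.
  have : 4 / s.+1%:R <= ka / 32.
    move: s1; rewrite !ler_pdivrMr //; set t := s.+1%:R => h.
    by rewrite mulrAC [ka * t]mulrC ler_pdivlMr //; lra.
  move: de2; move: (4 / s.+1%:R) (de ^+ 2) => u w h1 h2; clear -h1 h2; lra.
have [Y [x [Ax off]]] := cube_search k ep0 (ltW epA) ka0 (fun x y => sqr_ge0 _) Dka.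
pose z (v : 'rV['F_2]_k) := x + v *m Y.
pose b y := avg (fun a => F a y).
have offt : avg (fun v => avg (fun w => (v != w)%:R * D (z v) (z w))) <= tau * tau.
  apply: le_trans off _; rewrite ler_pdivrMr // /ka -/rho.
  by rewrite le_eqVlt; apply/orP; left; apply/eqP; field.
have [a ha] := avg_exists_le (ord0 : 'I_s.+1)
  (fun a => (bias R (fun v : 'rV_k => P a (z v)) - 3^-1) ^+ 2).
have avgE : avg (fun a => (bias R (fun v : 'rV_k => P a (z v)) - 3^-1) ^+ 2) =
   avg (fun v => avg (fun w => avg (fun a => (F a (z v) - 3^-1) * (F a (z w) - 3^-1)))).
  transitivity (avg (fun a => avg (fun v => avg (fun w =>
    (F a (z v) - 3^-1) * (F a (z w) - 3^-1))))).
    congr avg; apply/funext => a1; rewrite -avg_sqrE; congr (_ ^+ 2).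
    by rewrite avgB (avg_cst (0 : 'rV['F_2]_k)).
  by rewrite avg_exch; congr avg; apply/funext => v; rewrite [LHS]avg_exch.
rewrite avgE in ha.
have cellE (v w : 'rV['F_2]_k) : avg (fun a => (F a (z v) - 3^-1) * (F a (z w) - 3^-1)) =
    (avg (fun a => F a (z v) * F a (z w)) - b (z v) * b (z w)) +
    (b (z v) - 3^-1) * (b (z w) - 3^-1).
  have -> : (fun a => (F a (z v) - 3^-1) * (F a (z w) - 3^-1)) =
    (fun a => F a (z v) * F a (z w) - 3^-1 * F a (z v) - (3^-1 * F a (z w) - 9^-1)).
    by apply/funext => a1; field.
  rewrite avgB [X in X - _]avgB [X in _ - X]avgB (avg_cst (ord0 : 'I_s.+1)).
  by rewrite [X in _ - X - _]avgZ [X in _ - (X - _)]avgZ -/(b (z v)) -/(b (z w)); field.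
(* A diagonal covariance is at most 1. Off the diagonal a covariance [y] satisfies
   [y <= tau + y^2 / tau], so the mean of [D] controls the sum. *)
have cell (v w : 'rV['F_2]_k) : avg (fun a => (F a (z v) - 3^-1) * (F a (z w) - 3^-1)) <=
    (w == v)%:R + (tau + tau^-1 * ((v != w)%:R * D (z v) (z w))) + de' ^+ 2.
  rewrite cellE; apply: lerD.
    rewrite [w == v]eq_sym; have [<-|vw] := eqVneq v w.
      rewrite mul0r mulr0 addr0; apply: (@le_trans _ _ 1); last by rewrite lerDl ltW.
      rewrite lerBlDr; apply: (@le_trans _ _ 1); last by rewrite lerDl -expr2 sqr_ge0.
      apply: (avg_le (ord0 : 'I_s.+1)) => a1; by rewrite /F sgM.
    rewrite add0r mul1r /D -/(b (z v)) -/(b (z w)); set y := _ - _.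
    rewrite -(ler_pM2l tau0) [leRHS]mulrDr mulVKf ?gt_eqF //.
    have := sqr_ge0 (tau - y); have := sqr_ge0 y; nra.
  have hv := Ax v; have hw := Ax w; rewrite /A -/(z v) -/(z w) in hv hw.
  rewrite -/(b (z v)) in hv; rewrite -/(b (z w)) in hw.
  apply: le_trans (ler_norm _) _; rewrite normrM expr2.
  by apply: ler_pM.
have tot : (bias R (fun v : 'rV_k => P a (z v)) - 3^-1) ^+ 2 <= d ^+ 2 / 8 + (tau + tau) + de' ^+ 2.
  apply: le_trans ha _.
  apply: (@le_trans _ _ (avg (fun v : 'rV['F_2]_k => avg (fun w : 'rV['F_2]_k =>
    (w == v)%:R + (tau + tau^-1 * ((v != w)%:R * D (z v) (z w))) + de' ^+ 2)))).
    by apply: ler_avg => v; apply: ler_avg => w; exact: cell.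
  have inner v : avg (fun w : 'rV['F_2]_k =>
      (w == v)%:R + (tau + tau^-1 * ((v != w)%:R * D (z v) (z w))) + de' ^+ 2) =
    2^-1 ^+ k + (tau + tau^-1 * avg (fun w => (v != w)%:R * D (z v) (z w))) + de' ^+ 2.
    rewrite avgD (avg_cst (0 : 'rV['F_2]_k)); congr (_ + _).
    rewrite avgD [X in _ + X]avgD (avg_cst (0 : 'rV['F_2]_k)) avgZ; congr (_ + _).
    rewrite /avg (bigD1 v) //= eqxx big1 ?addr0 ?mulr1; last by move=> w /negbTE->.
    by rewrite card_mx card_Fp // mul1n natrX exprVn.
  under eq_fun do rewrite inner.
  rewrite avgD (avg_cst (0 : 'rV['F_2]_k)) lerD2r avgD (avg_cst (0 : 'rV['F_2]_k)).
  apply: lerD => //; rewrite avgD (avg_cst (0 : 'rV['F_2]_k)) avgZ lerD2l.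
  by rewrite ler_pdivrMl.
have := gap _ _ (pdeg_cube Y x (PK a)); rewrite -/(z _) => gapa.
have : d ^+ 2 <= (bias R (fun v : 'rV_k => P a (z v)) - 3^-1) ^+ 2.
  by rewrite -[leRHS]ger0_norm ?sqr_ge0 // normrX lerXn2r // nnegrE // ltW.
by move: tot; rewrite /tau /de'; have := d0; nra.
Qed.

End Families.

(** * Limit polynomials *)

#[local] Existing Instance ultra_proper.

(** * Limits of real sequences along an ultrafilter *)

Section UltraLimits.
Variables (R : realType) (U : set_system nat).
Context {UU : UltraFilter U}.
Implicit Types u v : nat -> R.


Definition ulim u : R := lim (u @ U).

(** Compactness of the segment gives a cluster point, and an ultrafilter converges to each of its
    cluster points. *)
Lemma ultra_cvg u (b : R) : (forall n, `|u n| <= b) -> u @ U --> ulim u.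
Proof.
move=> ub; suff [l ul] : exists l : R, u @ U --> l by exact: (@cvgP R _ l ul).
have Fb : (u @ U) `[- b, b]%classic.
  rewrite /fmap /=; apply: filterS (@filterT _ U _) => n _ /=.
  by rewrite in_itv /= -ler_norml.
have [l [_ cl]] := segment_compact _ Fb.
exists l; apply/cvgrPdist_lt => e e0; near_simpl.
have [//|nU] := in_ultra_setVsetC [set n | `|l - u n| < e] UU.
have [x [/= h1]] := cl [set x | ~ `|l - x| < e] _ nU (nbhsx_ballx l e e0).
by rewrite -ball_normE.
Qed.

Lemma ulimE u l : u @ U --> l -> ulim u = l.
Proof. by move=> ul; apply: cvg_lim ul; apply: norm_hausdorff. Qed.

Lemma cvg_le_ultra u v (a b : R) :
  u @ U --> a -> v @ U --> b -> (forall n, u n <= v n) -> a <= b.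
Proof. by move=> ua vb uv; apply: ler_cvg_to ua vb _; apply: nearW. Qed.

Lemma cvg_le_cst u (a b : R) : u @ U --> a -> (\forall n \near U, u n <= b) -> a <= b.
Proof. by move=> ua ub; apply: cvgr_to_le ua ub. Qed.

Lemma cvg_ge_cst u (a b : R) : u @ U --> a -> (\forall n \near U, b <= u n) -> b <= a.
Proof. by move=> ua ub; apply: cvgr_to_ge ua ub. Qed.

Lemma cvg_sum_ultra (I : finType) (u : I -> nat -> R) (a : I -> R) :
  (forall i, u i @ U --> a i) -> (fun n => \sum_i u i n) @ U --> \sum_i a i.
Proof. by move=> ua; apply: cvg_big => //; exact: add_continuous. Qed.

Lemma cvg0_le u v : (forall n, `|u n| <= v n) -> v @ U --> 0 -> u @ U --> 0.
Proof.
move=> uv v0; apply/norm_cvg0P; apply: squeeze_cvgr (cvg_cst (0:R)) v0.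
by near=> n; rewrite normr_ge0 uv.
Unshelve. all: end_near. Qed.

Lemma cvg0_approx u :
  (forall e : R, 0 < e ->
    exists2 v : nat -> R, v @ U --> 0 & \forall n \near U, `|u n - v n| <= e) ->
  u @ U --> 0.
Proof.
move=> ap; apply/cvgr0Pnorm_lt => e e0.
have e2 : 0 < e / 2 by rewrite divr_gt0.
have [v v0 uv] := ap _ e2.
have /cvgr0Pnorm_lt /(_ (e / 2) e2) ve := v0.
near=> n.
have h1 : `|u n - v n| <= e / 2 by near: n.
have h2 : `|v n| < e / 2 by near: n.
rewrite -[u n](subrK (v n)); apply: le_lt_trans (ler_normD _ _) _.
by lra.
Unshelve. all: end_near. Qed.

End UltraLimits.

(** * Fourier expansion over the field with two elements *)

Section Characters.
Variables (R : realType) (J : finType).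
Implicit Types c p r : {ffun J -> bool}.

(** Here [bool] serves as the field with two elements, so the sum is an exclusive or. *)
Definition dot c r : bool := \sum_j c j * r j.

Lemma dotDr c p r : dot c (p + r) = dot c p (+) dot c r.
Proof. by rewrite /dot -[RHS]big_split; apply: eq_bigr => j _; rewrite ffunE mulrDr. Qed.

Lemma dotDl p r c : dot (p + r) c = dot p c (+) dot r c.
Proof. by rewrite /dot -[RHS]big_split; apply: eq_bigr => j _; rewrite ffunE mulrDl. Qed.

Lemma dot0l r : dot 0 r = false.
Proof. by rewrite /dot big1 // => j _; rewrite ffunE mul0r. Qed.

Lemma dot_suml (I : finType) (c : I -> {ffun J -> bool}) r :
  dot (\sum_i c i) r = \sum_i dot (c i) r.
Proof. by apply: (big_morph (fun c => dot c r)); [move=> p q; exact: dotDl|exact: dot0l]. Qed.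

Lemma sg_sum (I : finType) (b : I -> bool) : sg R (\sum_i b i) = \prod_i sg R (b i).
Proof. by apply: (big_morph (sg R)); [move=> p q; exact: sgD|]. Qed.

Lemma sum_char r : \sum_c sg R (dot c r) = (r == 0)%:R * 2 ^+ #|J|.
Proof.
transitivity (\sum_(c : {ffun J -> bool}) \prod_j sg R (c j && r j)).
  by apply: eq_bigr => c _; rewrite /dot sg_sum.
rewrite -(bigA_distr_bigA (fun j b => sg R (b && r j))) /=.
have [->|r0] := eqVneq r 0.
  rewrite mul1r -prodr_const; apply: eq_bigr => j _.
  by rewrite big_bool ffunE /= /sg expr0; lra.
have [j rj] : exists j, r j.
  apply: contrapT => /forallNP h; move/eqP: r0; apply.
  by apply/ffunP => j; rewrite ffunE; apply/negbTE/negP/h.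
by rewrite (bigD1 j) //= big_bool rj /= /sg expr0 expr1 addNr !mul0r.
Qed.

Lemma char_delta p r :
  (p == r)%:R = (2 ^+ #|J|)^-1 * \sum_c sg R (dot c r) * sg R (dot c p).
Proof.
under eq_bigr do rewrite -sgD -dotDr.
rewrite sum_char mulrCA mulVf ?mulr1 ?expf_neq0 ?pnatr_eq0 //.
rewrite addr_eq0 eq_sym; congr ((r == _)%:R); apply/ffunP => j.
by rewrite ffunE; case: (p j).
Qed.

Lemma fourier (h : {ffun J -> bool} -> R) p :
  h p = \sum_c ((2 ^+ #|J|)^-1 * \sum_r h r * sg R (dot c r)) * sg R (dot c p).
Proof.
transitivity (\sum_r h r * (p == r)%:R).
  rewrite (bigD1 p) //= eqxx mulr1 big1 ?addr0 // => r rp.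
  by rewrite eq_sym (negbTE rp) mulr0.
under eq_bigr do rewrite char_delta mulrCA big_distrr big_distrr /=.
rewrite exchange_big; apply: eq_bigr => c _ /=.
rewrite -mulrA big_distrl big_distrr /=; apply: eq_bigr => r _; ring.
Qed.

End Characters.

Lemma pr_comb (R : realType) (V : finZmodType) (J : finType)
    (F : {ffun J -> bool} -> bool) (S T : J -> V -> bool) :
  pr R (xorf (fun x => F [ffun j => S j x]) (fun x => F [ffun j => T j x]))
    <= \sum_j pr R (xorf (S j) (T j)).
Proof.
rewrite -avg_sum; apply: ler_avg => x.
have [e|ne] := eqVneq [ffun j => S j x] [ffun j => T j x].
  by rewrite /xorf e addbb sumr_ge0.
have [j Nj] : exists j, S j x != T j x.
  apply: contrapT => /forallNP h; move/eqP: ne; apply.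
  by apply/ffunP => j; rewrite !ffunE; apply/eqP; apply/negPn/negP/h.
apply: (@le_trans _ _ 1); first by rewrite lern1 leq_b1.
rewrite (bigD1 j) //=.
have -> : xorf (S j) (T j) x by move: Nj; rewrite /xorf; case: (S j x); case: (T j x).
by rewrite lerDl sumr_ge0.
Qed.

(* Bogdanov and Viola: the mean of [(-1)^(der y f x)] over [y] is [(-1)^(f x)] times the bias. *)
Lemma biased_threshold (R : realType) (V : finZmodType) (f : V -> bool) (t : nat) (b : R) :
  (0 < t)%N -> 0 < b * bias R f ->
  exists y : {ffun 'I_t -> V},
    bias R f ^+ 2 * pr R (xorf f (fun x => b * \sum_i sg R (der (y i) f x) < 0)) <= t%:R^-1.
Proof.
move=> t0 bb; set be := bias R f in bb *.
have tn0 : t%:R != 0 :> R by rewrite pnatr_eq0 -lt0n.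
have Vn0 : #|V|%:R != 0 :> R := card_neq0 R (0 : V).
(* For fixed [x] the empirical mean of [t] independent samples of [sg (f (x + y))] has expectation
   [be] and variance at most [1 / t]. *)
have var x : avg (fun y : {ffun 'I_t -> V} => (t%:R^-1 * \sum_i sg R (f (x + y i)) - be) ^+ 2)
             <= t%:R^-1.
  pose g (z : V) := sg R (f (x + z)) - be.
  have g0 : avg g = 0.
    by rewrite avgB (avg_cst (0 : V)) (avg_shiftl x (fun z => sg R (f z))) subrr.
  have := @sum_iid_sqr R V (fun=> #|V|%:R^-1) g t [set: 'I_t]%SET.
  rewrite sumr_const -[_ *+ _]mulr_natr mulVf // -big_distrr /= -/(avg g) g0.
  move=> /(_ erefl erefl); rewrite cardsT card_ord prodr_const card_ord.
  have -> : \sum_(z : V) #|V|%:R^-1 * g z ^+ 2 = avg (fun z => g z ^+ 2).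
    by rewrite /avg big_distrr.
  rewrite -big_distrr /= => E.
  have -> : (fun y : {ffun 'I_t -> V} => (t%:R^-1 * \sum_i sg R (f (x + y i)) - be) ^+ 2) =
            (fun y : {ffun 'I_t -> V} => t%:R^-2 * (\sum_(i in [set: 'I_t]%SET) g (y i)) ^+ 2).
    apply/funext => y; rewrite /g sumrB sumr_const cardsT card_ord -exprVn -exprMn.
    congr (_ ^+ 2); rewrite mulrBr -[be *+ t]mulr_natl mulrA mulVf // mul1r.
    by congr (_ * _ - _); apply: eq_bigl => i; rewrite inE.
  rewrite avgZ; set A := avg _.
  have -> : A = t%:R * avg (fun z => g z ^+ 2).
    rewrite -E /A /avg card_ffun card_ord natrX exprVn; congr (_ * _).
  rewrite expr2 invfM -mulrA [X in _ * X]mulrA mulVf // mul1r.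
  rewrite ler_piMr ?invr_ge0 ?ler0n //.
  have -> : avg (fun z => g z ^+ 2) = 1 - be ^+ 2.
    have -> : (fun z => g z ^+ 2) = (fun z => 1 + be ^+ 2 - 2 * be * sg R (f (x + z))).
      apply/funext => z; rewrite /g sqrrB expr2 sgM; ring.
    rewrite avgB avgZ (avg_cst (0 : V)) (avg_shiftl x (fun z => sg R (f z))).
    by rewrite -/(bias R f) -/be; ring.
  by rewrite gerBl sqr_ge0.
have [y hy] := avg_exists_le (0 : {ffun 'I_t -> V})
  (fun y : {ffun 'I_t -> V} => avg (fun x => (t%:R^-1 * \sum_i sg R (f (x + y i)) - be) ^+ 2)).
exists y; rewrite avg_exch in hy.
apply: le_trans (le_trans hy (avg_le (0 : V) var)).
rewrite -avgZ; apply: ler_avg => x.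
have [|_] := boolP (xorf _ _ x); last by rewrite mulr0 sqr_ge0.
rewrite mulr1 /xorf.
set S := \sum_i sg R (f (x + y i)).
have -> : \sum_i sg R (der (y i) f x) = sg R (f x) * S.
  by rewrite big_distrr /=; apply: eq_bigr => i _; rewrite sgD mulrC.
have t1 : 0 < t%:R^-1 :> R by rewrite invr_gt0 ltr0n.
move=> hx.
(* Where the threshold errs, the empirical mean [s] and [be] do not have the same strict sign, so
   [(s - be)^2 >= be^2]. *)
have bS : b * S <= 0.
  move: hx; case: (f x); rewrite /sg ?expr0 ?expr1 /= ?mulN1r ?mul1r ?mulrN ?oppr_lt0 -?leNgt //.
  by move/ltW.
have : 0 < b ^+ 2 by rewrite exprn_even_gt0 //=; apply/eqP => b0; move: bb; rewrite b0 mul0r ltxx.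
set s := t%:R^-1 * S.
have bs : b * s <= 0 by rewrite /s mulrCA pmulr_rle0.
have : be * s * b ^+ 2 <= 0.
  have -> : be * s * b ^+ 2 = (b * be) * (b * s) by ring.
  by rewrite pmulr_rle0.
move=> h1 h2; rewrite pmulr_lle0 // in h1.
by rewrite sqrrB; have := sqr_ge0 s; rewrite mulr2n; lra.
Qed.

(** * Limit functions and their measure *)

Section LimitFunctions.
Variables (R : realType) (U : set_system nat).
Context {UU : UltraFilter U}.
Variable m : nat -> nat.
Local Notation V n := 'rV['F_2]_(m n).

(** A sequence represents a function on the ultraproduct of the spaces [V n]. No quotient is taken:
    almost everywhere equality is [mu (xorL f g) = 0]. *)
Definition limfun := forall n, V n -> bool.
Implicit Types f g h : limfun.

Definition xorL f g : limfun := fun n => xorf (f n) (g n).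
Definition comb (J : finType) (F : {ffun J -> bool} -> bool) (B : J -> limfun) : limfun :=
  fun n x => F [ffun j => B j n x].
Definition dotL (J : finType) (c : {ffun J -> bool}) (B : J -> limfun) : limfun :=
  comb (dot c) B.

Definition mu f : R := ulim U (fun n => pr R (f n)).
Definition oddL M f : R := ulim U (fun n => oddcube R M (f n)).

Lemma limfun_ext f g : (forall n x, f n x = g n x) -> f = g.
Proof. by move=> fg; apply: functional_extensionality_dep => n; apply/funext. Qed.

Lemma mu_cvg f : (fun n => pr R (f n)) @ U --> mu f.
Proof. by apply: (@ultra_cvg _ _ _ _ 1) => n; rewrite ger0_norm ?pr_ge0 ?pr_le1. Qed.

Lemma oddL_cvg M f : (fun n => oddcube R M (f n)) @ U --> oddL M f.
Proof.
apply: (@ultra_cvg _ _ _ _ (2 ^+ M)) => n; rewrite ger0_norm ?oddcube_ge0 //.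
by apply: le_trans (oddcube_le_pr _ _ _) _; rewrite ler_piMr ?exprn_ge0 ?pr_le1.
Qed.

Lemma mu_ge0 f : 0 <= mu f.
Proof. by apply: (cvg_ge_cst (@mu_cvg f)); apply: nearW => n; exact: pr_ge0. Qed.

Lemma oddL_ge0 M f : 0 <= oddL M f.
Proof. by apply: (cvg_ge_cst (@oddL_cvg M f)); apply: nearW => n; exact: oddcube_ge0. Qed.

Lemma mu_tri f g h : mu (xorL f h) <= mu (xorL f g) + mu (xorL g h).
Proof.
apply: (cvg_le_ultra (@mu_cvg _) (cvgD (@mu_cvg _) (@mu_cvg _))) => n.
exact: pr_tri.
Qed.

Lemma muC f g : mu (xorL f g) = mu (xorL g f).
Proof. by congr mu; apply: limfun_ext => n x; rewrite /xorL /xorf addbC. Qed.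

Lemma mu_xorff f : mu (xorL f f) = 0.
Proof.
apply: ulimE; rewrite (_ : (fun n => _) = fun=> 0); first exact: cvg_cst.
apply/funext => n; rewrite /xorL xorff /pr; exact: (avg_cst (0 : V n)).
Qed.

Lemma mu_dist f g : mu f <= mu g + mu (xorL f g).
Proof.
apply: (cvg_le_ultra (@mu_cvg _) (cvgD (@mu_cvg _) (@mu_cvg _))) => n.
rewrite {1}(_ : f n = xorf (xorf (f n) (g n)) (g n)) 1?addrC ?pr_xor_le //.
by rewrite -xorfA xorff xorf0.
Qed.

Lemma oddL_xor M f g : oddL M (xorL f g) <= oddL M f + oddL M g.
Proof.
apply: (cvg_le_ultra (@oddL_cvg _ _) (cvgD (@oddL_cvg _ _) (@oddL_cvg _ _))) => n.
exact: oddcube_xor.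
Qed.

Lemma oddL_le_mu M f : oddL M f <= 2 ^+ M * mu f.
Proof.
apply: (cvg_le_ultra (@oddL_cvg _ _) (@cvgMl_tmp _ _ _ _ _ (2 ^+ M) _ (@mu_cvg _))) => n.
exact: oddcube_le_pr.
Qed.

Lemma oddL_sep M f : mu f * (1 - 2 ^+ M * mu f) <= oddL M f.
Proof.
apply: (cvg_le_ultra _ (@oddL_cvg _ _)) => [|n]; last exact: oddcube_sep.
apply: cvgM; first exact: (@mu_cvg f).
by apply: cvgB; [exact: cvg_cst|apply: cvgMl_tmp; exact: (@mu_cvg f)].
Qed.

End LimitFunctions.

Arguments xorL {m} f g n x.
Arguments comb {m J} F B n x.
Arguments dotL {m J} c B n x.
Arguments mu_cvg {R U UU m} f [t] _.
Arguments oddL_cvg {R U UU m} M f [t] _.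
Arguments mu_ge0 {R U UU m} f.
Arguments oddL_ge0 {R U UU m} M f.
Arguments mu_tri {R U UU m} f g h.
Arguments muC {R U m} f g.
Arguments mu_xorff {R U UU m} f.
Arguments mu_dist {R U UU m} f g.
Arguments oddL_xor {R U UU m} M f g.
Arguments oddL_le_mu {R U UU m} M f.
Arguments oddL_sep {R U UU m} M f.

(** * Limits of functions of polynomials of lower degree *)

Section Approximable.
Variables (R : realType) (U : set_system nat).
Context {UU : UltraFilter U}.
Variable m : nat -> nat.
Local Notation V n := 'rV['F_2]_(m n).
Local Notation limfun := (limfun m).
Local Notation mu := (@mu R U m).
Implicit Types f g h : limfun.

Definition pdegL k f := forall n, pdeg k (f n).

(* Limits in measure of functions of finitely many polynomials of degree [< k]. *)
Definition polylim k f := forall e : R, 0 < e ->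
  exists (J : finType) (B : J -> limfun) (F : {ffun J -> bool} -> bool),
    (forall j, pdegL k (B j)) /\ mu (xorL f (comb F B)) <= e.

Lemma pdegL_xor k f g : pdegL k f -> pdegL k g -> pdegL k (xorL f g).
Proof. by move=> Gf Gg n; apply: pdeg_xor. Qed.

Lemma dotLE (J : finType) (c : {ffun J -> bool}) (B : J -> limfun) n x :
  dotL c B n x = \sum_j (c j && B j n x) :> bool.
Proof. by rewrite /dotL /comb /dot; apply: eq_bigr => j _; rewrite ffunE. Qed.

Lemma pdeg_sum (W : finZmodType) (I : Type) (r : seq I) k (f : I -> W -> bool) :
  (forall i, pdeg k (f i)) -> pdeg k (fun x => \sum_(i <- r) f i x).
Proof.
move=> pf; elim: r => [|i r IH].
  rewrite (_ : (fun x => _) = fun=> false); first exact: pdeg0.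
  by apply/funext => x; rewrite big_nil.
rewrite (_ : (fun x => _) = xorf (f i) (fun x => \sum_(j <- r) f j x)); first exact: pdeg_xor.
by apply/funext => x; rewrite big_cons.
Qed.

Lemma pdegL_dot (J : finType) k (c : {ffun J -> bool}) (B : J -> limfun) :
  (forall j, pdegL k (B j)) -> pdegL k (dotL c B).
Proof.
move=> GB n; rewrite (_ : dotL c B n = fun x => \sum_j (c j && B j n x)); last first.
  by apply/funext => x; exact: dotLE.
apply: pdeg_sum => j; case: (c j); first exact: GB.
exact: pdeg0.
Qed.

Lemma mu_comb (J : finType) (F : {ffun J -> bool} -> bool) (S T : J -> limfun) :
  mu (xorL (comb F S) (comb F T)) <= \sum_j mu (xorL (S j) (T j)).
Proof.
apply: (cvg_le_ultra (mu_cvg _) (cvg_sum_ultra (fun j => mu_cvg _))) => n.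
exact: pr_comb.
Qed.

Lemma pdegL_polylim k f : pdegL k f -> polylim k f.
Proof.
move=> Gf e e0; exists unit, (fun=> f), (fun r => r tt); split => //.
rewrite (_ : comb _ _ = f) ?mu_xorff ?ltW //.
by apply: limfun_ext => n x; rewrite /comb ffunE.
Qed.

Lemma polylim_lim k f :
  (forall e : R, 0 < e -> exists2 g, polylim k g & mu (xorL f g) <= e) -> polylim k f.
Proof.
move=> H e e0; have e2 : 0 < e / 2 by rewrite divr_gt0.
have [g Cg fg] := H _ e2; have [J [B [F [GB gB]]]] := Cg _ e2.
exists J, B, F; split => //; apply: le_trans (mu_tri _ g _) _; lra.
Qed.

Lemma polylim_comb k (J : finType) (F : {ffun J -> bool} -> bool) (T : J -> limfun) :
  (forall j, polylim k (T j)) -> polylim k (comb F T).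
Proof.
move=> CT e e0; pose d := e / #|J|.+1%:R.
have d0 : 0 < d by rewrite divr_gt0 ?ltr0Sn.
have H0 j : exists p : {I : finType & ((I -> limfun) * ({ffun I -> bool} -> bool))%type},
    (forall i, pdegL k ((projT2 p).1 i)) /\ mu (xorL (T j) (comb (projT2 p).2 (projT2 p).1)) <= d.
  by have [I [B [G H]]] := CT j d d0; exists (existT _ I (B, G)).
have [p H] := choice H0.
pose I j := projT1 (p j); pose B j := (projT2 (p j)).1; pose G j := (projT2 (p j)).2.
pose K := {j : J & I j}.
exists K, (fun p => B (tag p) (tagged p)),
  (fun r => F [ffun j => G j [ffun i => r (Tagged I i)]]).
split; first by move=> [j i]; apply: (proj1 (H j)).
have -> : comb (fun r : {ffun K -> bool} => F [ffun j => G j [ffun i => r (Tagged I i)]])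
            (fun p : K => B (tag p) (tagged p)) = comb F (fun j => comb (G j) (B j)).
  apply: limfun_ext => n x; rewrite /comb; congr F; apply/ffunP => j; rewrite !ffunE.
  by congr (G j); apply/ffunP => i; rewrite !ffunE.
apply: le_trans (mu_comb _ _ _) _.
apply: (@le_trans _ _ (\sum_(j : J) d)); first by apply: ler_sum => j _; exact: (proj2 (H j)).
rewrite sumr_const -[_ *+ _]mulr_natr /d -mulrA ler_piMr ?(ltW e0) //.
by rewrite mulrC ler_pdivrMr ?ltr0Sn // mul1r ler_nat.
Qed.

Lemma polylim_xor k f g : polylim k f -> polylim k g -> polylim k (xorL f g).
Proof.
move=> Cf Cg.
have -> : xorL f g = comb (fun r : {ffun bool -> bool} => r true (+) r false)
                          (fun b => if b then f else g).
  by apply: limfun_ext => n x; rewrite /comb !ffunE.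
by apply: polylim_comb => -[].
Qed.

Lemma xorLK f g : xorL f (xorL f g) = g.
Proof. by apply: limfun_ext => n x; rewrite /xorL xorfK. Qed.

Lemma polylim_xorl k f g : polylim k f -> polylim k (xorL f g) -> polylim k g.
Proof. by move=> Cf Cfg; rewrite -(xorLK f g); exact: polylim_xor. Qed.

(** The threshold function of [biased_threshold] depends on derivatives of [f], which have lower
    degree, and their number [t] depends on [b] and [e] but not on [n]. *)
Lemma biased_polylim k f : pdegL k.+1 f -> 1 - 2 * mu f != 0 -> polylim k f.
Proof.
move=> Gf; set b := 1 - 2 * mu f => b0 e e0.
have bc : (fun n => bias R (f n)) @ U --> b.
  rewrite (_ : (fun n => _) = (fun n => 1 - 2 * pr R (f n))); last first.
    by apply/funext => n; exact: biasE.
  by apply: cvgB; [exact: cvg_cst|apply: cvgMl_tmp; exact: (mu_cvg _)].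
have bb : 0 < b ^+ 2 by rewrite exprn_even_gt0.
(* Near the limit the squared bias is at least [b^2 / 4], so an error of [1 / t <= b^2 / 4 * e]
   bounds the measure by [e]. *)
pose t := (Num.truncn (4 / (b ^+ 2 * e))).+1.
have te : 4 / (b ^+ 2 * e) <= t%:R by rewrite ltW // truncnS_gt.
have H n : exists y : {ffun 'I_t -> V n}, 0 < b * bias R (f n) ->
   bias R (f n) ^+ 2 *
     pr R (xorf (f n) (fun x => b * \sum_i sg R (der (y i) (f n) x) < 0)) <= t%:R^-1.
  (* Indices with a bias of the wrong sign are negligible for [U]; the directions there are
     arbitrary. *)
  have [bn|bn] := boolP (0 < b * bias R (f n)); last by exists [ffun=> 0].
  have [y hy] := biased_threshold (isT : 0 < t)%N bn.
  by exists y.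
pose y n := projT1 (cid (H n)).
have hy n : 0 < b * bias R (f n) -> bias R (f n) ^+ 2 *
  pr R (xorf (f n) (fun x => b * \sum_i sg R (der (y n i) (f n) x) < 0)) <= t%:R^-1 :=
  projT2 (cid (H n)).
exists 'I_t, (fun i n => der (y n i) (f n)), (fun r => b * \sum_i sg R (r i) < 0).
split; first by move=> i n; apply: Gf.
apply: (cvg_le_cst (mu_cvg _)).
have b2 : 0 < `|b| / 2 by rewrite divr_gt0 ?normr_gt0.
have /cvgrPdist_lt /(_ _ b2) bn := bc.
near=> n.
have hn : `|b - bias R (f n)| < `|b| / 2 by near: n.
have [p1 p2] : 0 < b * bias R (f n) /\ b ^+ 2 / 4 <= bias R (f n) ^+ 2.
  move: hn; case: (ltgtP b 0) b0 => // s _.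
    by rewrite (ltr0_norm s) ltr_norml => /andP[h1 h2]; split; nra.
  by rewrite (gtr0_norm s) ltr_norml => /andP[h1 h2]; split; nra.
have := hy n p1.
set P := pr R _; rewrite /xorL (_ : pr R _ = P); last first.
  rewrite /P; congr pr; apply/funext => x; rewrite /xorf; congr (_ (+) _).
  by rewrite /comb; congr (b * _ < 0); apply: eq_bigr => i _; rewrite ffunE.
move=> h.
have P0 : 0 <= P by exact: pr_ge0.
have t0 : 0 < t%:R :> R by rewrite ltr0Sn.
have h1 : b ^+ 2 / 4 * P <= t%:R^-1 by apply: le_trans h; rewrite ler_wpM2r.
have b4 : 0 < b ^+ 2 / 4 by rewrite divr_gt0.
have h2 : t%:R^-1 <= b ^+ 2 / 4 * e.
  rewrite invf_ple ?posrE ?(mulr_gt0 b4 e0) //.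
  by rewrite (_ : (_ * e)^-1 = 4 / (b ^+ 2 * e)) // !invfM invrK; ring.
have h3 := le_trans h1 h2.
by move: h3; rewrite ler_pM2l.
Unshelve. all: end_near. Qed.

(** Induction on the list of factors. Up to a small error a factor is a function of polynomials of
    lower degree; its characters are absorbed into [K], which stays equal to [B] modulo lower
    degree. Without factors, a nonzero limiting bias of [K] would put [K], hence [B], into
    [polylim k]. In the application [y] is the matrix of directions of a cube and [s] gives its
    vertices. *)
Lemma vanishing k (B : limfun) (Y : nat -> finType) (y0 : forall n, Y n)
    (O : Type) (l : seq O) (g : O -> limfun) (s : O -> forall n, Y n -> V n)
    (K : forall n, Y n -> V n -> bool) :
  pdegL k.+1 B -> ~ polylim k B -> (forall n y, pdeg k (xorf (K n y) (B n))) ->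
  (forall o, polylim k (g o)) ->
  (fun n => avg (fun y => avg (fun x =>
     sg R (K n y x) * \prod_(o <- l) sg R (g o n (x + s o n y))))) @ U --> 0.
Proof.
move=> GB nB KB Cg; elim: l K KB => [|o l IH] K KB.
  have H n : exists y, `|avg (fun y => avg (fun x =>
     sg R (K n y x) * \prod_(o <- [::]) sg R (g o n (x + s o n y))))| <= `|bias R (K n y)|.
    have [y hy] := avg_exists_norm (y0 n) (fun y => bias R (K n y)).
    exists y; apply: le_trans hy; rewrite le_eqVlt; apply/orP; left; apply/eqP.
    congr (`|avg _|); apply/funext => y'; congr avg; apply/funext => x.
    by rewrite big_nil mulr1.
  pose y n := projT1 (cid (H n)).
  have hy n : _ <= `|bias R (K n (y n))| := projT2 (cid (H n)).
  pose K' : limfun := fun n => K n (y n).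
  have GK' : pdegL k (xorL K' B) by move=> n; exact: KB.
  have GK : pdegL k.+1 K'.
    have -> : K' = xorL (xorL K' B) B.
      by apply: limfun_ext => n x; rewrite /xorL -xorfA xorff xorf0.
    by apply: pdegL_xor => // n; apply: pdegS; apply: GK'.
  apply: cvg0_le hy _.
  have -> : (0 : R) = `|1 - 2 * mu K'|.
    apply/eqP; rewrite eq_sym normr_eq0; apply/negPn/negP => b0; apply: nB.
    by apply: (polylim_xorl (biased_polylim GK b0)); apply: pdegL_polylim.
  apply: cvg_norm.
  rewrite (_ : (fun n => _) = (fun n => 1 - 2 * pr R (K' n))); last first.
    by apply/funext => n; rewrite biasE.
  by apply: cvgB; [exact: cvg_cst|apply: cvgMl_tmp; exact: (mu_cvg _)].
apply: cvg0_approx => e e0.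
have e4 : 0 < e / 4 by rewrite divr_gt0.
have [J [D [F [GD gD]]]] := Cg o _ e4.
(* In [v] the first factor is replaced by its approximation; [w c] is the contribution of the
   character [c], to which the induction hypothesis applies. *)
pose v n := avg (fun y => avg (fun x => sg R (K n y x) *
   (sg R (comb F D n (x + s o n y)) * \prod_(o <- l) sg R (g o n (x + s o n y))))) : R.
pose w c n := avg (fun y => avg (fun x => sg R (K n y x (+) dotL c D n (x + s o n y)) *
    \prod_(o <- l) sg R (g o n (x + s o n y)))) : R.
pose F' c : R := (2 ^+ #|J|)^-1 * \sum_r sg R (F r) * sg R (dot c r).
have vw : v = fun n => \sum_c F' c * w c n.
  apply/funext => n; rewrite /v /w.
  under [RHS]eq_bigr do rewrite -avgZ.
  rewrite -avg_sum; congr avg; apply/funext => y.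
  under [RHS]eq_bigr do rewrite -avgZ.
  rewrite -avg_sum; congr avg; apply/funext => x.
  rewrite {1}/comb (fourier (fun r => sg R (F r))) big_distrl big_distrr /=.
  by apply: eq_bigr => c _; rewrite -/(F' c) sgD /dotL /comb; ring.
exists v.
  have wc c : w c @ U --> 0.
    apply: IH => n y.
    have -> : xorf (fun x => K n y x (+) dotL c D n (x + s o n y)) (B n) =
              xorf (xorf (K n y) (B n)) (shift (s o n y) (dotL c D n)).
      by apply/funext => x; rewrite /xorf /shift addbAC.
    by apply: pdeg_xor => //; apply: pdeg_shift; apply: pdegL_dot.
  have h : (fun n => \sum_c F' c * w c n) @ U --> \sum_c F' c * 0.
    by apply: cvg_sum_ultra => c; apply: cvgMl_tmp.
  by rewrite vw; rewrite [X in _ --> X]big1 in h => // c _; rewrite mulr0.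
have gc : (fun n => pr R (xorL (g o) (comb F D) n)) @ U --> mu (xorL (g o) (comb F D)).
  exact: mu_cvg.
have /cvgrPdist_lt /(_ _ e4) gn := gc.
near=> n.
have hn : `|mu (xorL (g o) (comb F D)) - pr R (xorL (g o) (comb F D) n)| < e / 4 by near: n.
have pn : 2 * pr R (xorL (g o) (comb F D) n) <= e.
  by move: hn; rewrite ltr_norml => /andP[]; lra.
apply: le_trans pn; rewrite /v -avgB.
apply: le_trans (ler_norm_avg _) _.
apply: (avg_le (y0 n)) => y; rewrite -avgB; apply: le_trans (ler_norm_avg _) _.
rewrite -(pr_shift _ (s o n y)) -avgZ; apply: ler_avg => x.
rewrite big_cons -mulrBr normrM norm_sg mul1r -mulrBl normrM.
rewrite [X in _ * X](_ : _ = 1); last first.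
  elim: l {IH v w vw} => [|o' l IHl]; first by rewrite big_nil normr1.
  by rewrite big_cons normrM norm_sg mul1r.
rewrite mulr1 /shift /xorL /xorf; set a := g o n _; set a' := comb _ _ _ _.
by case: a; case: a'; rewrite /sg ?expr0 ?expr1 /= ler_norml; lra.
Unshelve. all: end_near. Qed.

End Approximable.

(** * Independent limit polynomials *)

Section Independence.
Variables (R : realType) (U : set_system nat).
Context {UU : UltraFilter U}.
Variable m : nat -> nat.
Local Notation V n := 'rV['F_2]_(m n).
Local Notation limfun := (limfun m).
Local Notation mu := (@mu R U m).
Local Notation polylim := (@polylim R U m).
Local Notation oddL := (@oddL R U m).
Implicit Types f g h : limfun.

Definition glue (I : finType) (Q : I -> limfun) (G : {ffun I -> bool} -> limfun) : limfun :=
  fun n x => G [ffun i => Q i n x] n x.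

Arguments glue {I} Q G n x.

(** Linear independence of polynomials of degree at most [k] modulo [polylim k]. *)
Definition indep k (I : finType) (Q : I -> limfun) : Prop :=
  (forall i, pdegL k.+1 (Q i)) /\ forall c, c != 0 -> ~ polylim k (dotL c Q).

(** In [glue Q (rot u G)] the values of [Q] are translated by [u], while the point [x] at which the
    pieces are evaluated stays fixed. *)
Definition rot (I : finType) (u : {ffun I -> bool}) (G : {ffun I -> bool} -> limfun) :=
  fun r => G (r + u).

Lemma sg_glue (I : finType) (Q : I -> limfun) (G : {ffun I -> bool} -> limfun) u n x :
  sg R (glue Q (rot u G) n x) =
  \sum_p ((2 ^+ #|I|)^-1 * sg R (dot p.1 p.2) * sg R (dot p.1 u)) *
     (sg R (dotL p.1 Q n x) * sg R (G p.2 n x)).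
Proof.
rewrite /glue /rot; set q := [ffun i => Q i n x].
transitivity (\sum_r (q + u == r)%:R * sg R (G r n x)).
  rewrite (bigD1 (q + u)) //= eqxx mul1r big1 ?addr0 // => r rp.
  by rewrite eq_sym (negbTE rp) mul0r.
under eq_bigr do rewrite char_delta big_distrr big_distrl /=.
rewrite exchange_big /= pair_bigA /=; apply: eq_bigr => -[c r] _ /=.
by rewrite dotDr sgD /dotL /comb -/q; ring.
Qed.

(** Expand both cube averages into characters [c_v] of [Q], one for each vertex [v]. If the [c_v]
    sum to zero, the rotation leaves the coefficient unchanged. Otherwise the sum of the forms
    [dotL c_v Q] at the vertices is a nonzero form at [x] plus derivatives of lower degree, and the
    term tends to 0 by [vanishing]. *)
Lemma rotation k M (I : finType) (Q : I -> limfun) (G : {ffun I -> bool} -> limfun) u :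
  indep k Q -> (forall r, polylim k (G r)) ->
  oddL M (glue Q (rot u G)) = oddL M (glue Q G).
Proof.
move=> [GQ IQ] CG.
pose P := ({ffun I -> bool} * {ffun I -> bool})%type.
pose a u (p : P) : R := (2 ^+ #|I|)^-1 * sg R (dot p.1 p.2) * sg R (dot p.1 u).
pose W (q : {ffun 'rV['F_2]_M -> P}) n : R :=
  avg (fun Y : 'M['F_2]_(M, m n) => avg (fun x => \prod_v (sg R (dotL (q v).1 Q n (x + v *m Y))
    * sg R (G (q v).2 n (x + v *m Y))))).
have E u' n : cubeavg M (fun x => sg R (glue Q (rot u' G) n x)) =
    \sum_(q : {ffun 'rV['F_2]_M -> P}) (\prod_v a u' (q v)) * W q n.
  rewrite cubeavgE /W; under [RHS]eq_bigr do rewrite -avgZ.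
  rewrite -avg_sum; congr avg; apply/funext => Y.
  under [RHS]eq_bigr do rewrite -avgZ.
  rewrite -avg_sum; congr avg; apply/funext => x.
  under eq_bigr do rewrite sg_glue.
  rewrite bigA_distr_bigA /=; apply: eq_bigr => q _.
  by rewrite -big_split.
have rot0 : rot 0 G = G by apply/funext => r; rewrite /rot addr0.
have lim0 : (fun n => \sum_(q : {ffun 'rV['F_2]_M -> P})
    (\prod_v a u (q v) - \prod_v a 0 (q v)) * W q n) @ U --> 0.
  have h : (fun n => \sum_(q : {ffun 'rV['F_2]_M -> P})
    (\prod_v a u (q v) - \prod_v a 0 (q v)) * W q n) @ U -->
      \sum_(q : {ffun 'rV['F_2]_M -> P}) (0 : R).
    apply: cvg_sum_ultra => q.
    have [c0|c0] := eqVneq (\sum_v (q v).1) 0.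
      rewrite (_ : (fun n => _) = fun=> 0); first exact: cvg_cst.
      apply/funext => n; rewrite (_ : \prod_v a u (q v) = \prod_v a 0 (q v)) ?subrr ?mul0r //.
      rewrite /a !big_split /=; congr (_ * _).
      by rewrite -!sg_sum -!dot_suml c0 !dot0l.
    rewrite -(mulr0 (\prod_v a u (q v) - \prod_v a 0 (q v))); apply: cvgMl_tmp.
    rewrite (_ : W q = fun n => avg (fun Y : 'M['F_2]_(M, m n) => avg (fun x =>
       sg R (\sum_v dotL (q v).1 Q n (x + v *m Y)) *
       \prod_v sg R (G (q v).2 n (x + v *m Y))))); last first.
      apply/funext => n; congr avg; apply/funext => Y; congr avg; apply/funext => x.
      by rewrite big_split sg_sum.
    apply: (@vanishing R U _ m k (dotL (\sum_v (q v).1) Q) (fun n => 'M['F_2]_(M, m n)) (fun=> 0) _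
      (index_enum _) (fun v => G (q v).2) (fun v n Y => v *m Y)
      (fun n Y x => \sum_v dotL (q v).1 Q n (x + v *m Y))) => //.
    - exact: pdegL_dot.
    - exact: IQ.
    - move=> n Y; have -> : xorf (fun x => \sum_v dotL (q v).1 Q n (x + v *m Y))
          (dotL (\sum_v (q v).1) Q n) =
        (fun x => \sum_v der (v *m Y) (dotL (q v).1 Q n) x).
        apply/funext => x; rewrite /xorf /der {2}/dotL /comb dot_suml.
        by rewrite -[LHS]big_split.
      apply: pdeg_sum => v; have h := pdegL_dot (q v).1 GQ; exact: (h n (v *m Y)).
  by rewrite big1 in h.
have lim1 : (fun n => cubeavg M (fun x => sg R (glue Q (rot u G) n x)) -
    cubeavg M (fun x => sg R (glue Q G n x))) @ U --> 0.
  rewrite (_ : (fun n => _) = (fun n => \sum_(q : {ffun 'rV['F_2]_M -> P})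
    (\prod_v a u (q v) - \prod_v a 0 (q v)) * W q n)) //.
  apply/funext => n; rewrite -{2}rot0 !E -sumrB.
  by apply: eq_bigr => q _; rewrite mulrBl.
have lim2 : (fun n => cubeavg M (fun x => sg R (glue Q (rot u G) n x)) -
    cubeavg M (fun x => sg R (glue Q G n x))) @ U -->
    2 * (oddL M (glue Q G) - oddL M (glue Q (rot u G))).
  rewrite (_ : (fun n => _) = (fun n => 2 * (oddcube R M (glue Q G n) -
      oddcube R M (glue Q (rot u G) n)))); last first.
    by apply/funext => n; rewrite !cubeavg_sg; ring.
  by apply: cvgMl_tmp; apply: cvgB; exact: oddL_cvg.
have h : 2 * (oddL M (glue Q G) - oddL M (glue Q (rot u G))) = 0 :> R.
  exact: etrans (esym (ulimE lim2)) (ulimE lim1).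
lra.
Qed.

(** All rotations of the glued function have the same measure, and at each point the rotated values
    of [Q] run through every [r] once. So [Q] is equidistributed and independent of [polylim k]. *)
Lemma mu_glue k (I : finType) (Q : I -> limfun) (G : {ffun I -> bool} -> limfun) :
  indep k Q -> (forall r, polylim k (G r)) ->
  mu (glue Q G) = (2 ^+ #|I|)^-1 * \sum_r mu (G r).
Proof.
move=> IQ CG.
(* A cube of dimension 0 is a point, so [oddL 0] is [mu]. *)
have rotmu u : mu (glue Q (rot u G)) = mu (glue Q G) := rotation 0 u IQ CG.
have -> : \sum_r mu (G r) = \sum_u mu (glue Q (rot u G)).
  rewrite -(ulimE (cvg_sum_ultra (fun r => mu_cvg (G r)))).
  rewrite -(ulimE (cvg_sum_ultra (fun u => mu_cvg (glue Q (rot u G))))).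
  congr ulim; apply: functional_extensionality_dep => n.
  rewrite /pr -!avg_sum; congr avg; apply/funext => x.
  by rewrite (reindex_inj (addrI [ffun i => Q i n x])).
under eq_bigr do rewrite rotmu.
rewrite sumr_const -[mu _ *+ _]mulr_natl card_ffun card_bool natrX mulrA mulVf ?mul1r //.
Qed.

Lemma polylim_false k : polylim k (fun _ _ => false).
Proof. by apply: pdegL_polylim => n; exact: pdeg0. Qed.

Lemma sum_supp (K : finType) (S : {set K}) (F : K -> bool) :
  (forall x, x \notin S -> F x = false) -> \sum_x F x = \sum_(i < #|S|) F (enum_val i) :> bool.
Proof.
move=> h; rewrite (bigID (fun x => x \in S)) /= [X in _ + X]big1 => [|x xS]; last by apply: h.
by rewrite addr0; exact: big_enum_val.
Qed.

(** Basis extension: among the [Q i] and the polynomials [B j] approximating [f], take a maximal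
    independent set containing the [Q i]. Modulo [polylim k] every [B j] is a combination of its
    members, so with their values fixed the approximation lies in [polylim k]. *)
Lemma indep_extend k (I : finType) (Q : I -> limfun) f e :
  indep k Q -> polylim k.+1 f -> 0 < e ->
  exists (I' : finType) (emb : I -> I') (Q' : I' -> limfun) (G : {ffun I' -> bool} -> limfun),
    [/\ injective emb, forall i, Q' (emb i) = Q i, indep k Q', (forall r, polylim k (G r))
      & mu (xorL f (glue Q' G)) <= e].
Proof.
move=> [GQ IQ] Cf e0; have [J [B [F [GB fB]]]] := Cf _ e0.
pose K := (I + J)%type.
pose W (x : K) : limfun := match x with inl i => Q i | inr j => B j end.
have GW x : pdegL k.+1 (W x) by case: x.
pose ind (S : {set K}) := forall c : {ffun K -> bool}, c != 0 ->
  (forall x, c x -> x \in S) -> ~ polylim k (dotL c W).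
pose S0 : {set K} := [set x | if x is inl _ then true else false]%SET.
have indS0 : ind S0.
  move=> c c0 cS; have cJ j : c (inr j) = false.
    by apply/negbTE/negP => /cS; rewrite inE.
  have -> : dotL c W = dotL [ffun i => c (inl i)] Q.
    apply: limfun_ext => n x; rewrite !dotLE big_sumType /= [X in _ + X]big1 ?addr0.
      by apply: eq_bigr => i _; rewrite ffunE.
    by move=> j _; rewrite cJ.
  apply: IQ; apply: contraNneq c0 => /ffunP ci; apply/eqP/ffunP => -[i|j].
    by have := ci i; rewrite !ffunE.
  by rewrite cJ ffunE.
have [S /maxsetP[/andP[S0S /asboolP indS] Smax] _] :
    {S | maxset (fun S => (S0 \subset S) && `[< ind S >]) S & S0 \subset S}.
  by apply: maxset_exists; rewrite subxx; apply/asboolP.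
have hS i : inl i \in S by apply: (fintype.subsetP S0S); rewrite inE.
pose Q' (i : 'I_#|S|) := W (enum_val i).
have IQ' : indep k Q'.
  split=> [i|c c0]; first exact: GW.
  pose c' : {ffun K -> bool} := [ffun x => [exists i, (enum_val i == x) && c i]].
  have c'E i : c' (enum_val i) = c i.
    rewrite ffunE; apply/existsP/idP => [[i' /andP[/eqP/enum_val_inj->]]//|ci].
    by exists i; rewrite eqxx.
  have c'S x : c' x -> x \in S.
    by rewrite ffunE => /existsP[i /andP[/eqP<- _]]; exact: enum_valP.
  have -> : dotL c Q' = dotL c' W.
    apply: limfun_ext => n x; rewrite !dotLE (@sum_supp _ S).
      by apply: eq_bigr => i _; rewrite c'E.
    by move=> y yS; apply/negbTE; apply: contra yS => /andP[/c'S].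
  apply: indS c'S; apply: contraNneq c0 => c'0; apply/eqP/ffunP => i.
  by rewrite -c'E c'0 !ffunE.
have rep j : exists c : {ffun 'I_#|S| -> bool}, polylim k (xorL (B j) (dotL c Q')).
  have [jS|jS] := boolP (inr j \in S).
    exists [ffun i => enum_val i == inr j]; rewrite (_ : xorL _ _ = fun _ _ => false).
      exact: polylim_false.
    apply: limfun_ext => n x; rewrite /xorL /xorf dotLE.
    transitivity (B j n x (+) \sum_y ((y == inr j) && W y n x)).
      congr (_ (+) _); rewrite (@sum_supp _ S); first by apply: eq_bigr => i _; rewrite ffunE.
      by move=> y yS; case: eqP yS => // ->; rewrite jS.
    rewrite (bigD1 (inr j)) //= eqxx big1 ?addr0 ?addbb //.
    by move=> y /negbTE->.
  (* By maximality adding [inr j] creates a relation. It must involve [inr j], with coefficient 1,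
     and can thus be solved for [B j]. *)
  have [c [c0 [cS Cc]]] : exists c : {ffun K -> bool}, c != 0 /\
      (forall x, c x -> x \in inr j |: S) /\ polylim k (dotL c W).
    apply: contrapT => H; have : inr j |: S = S.
      apply: Smax; last exact: finset.subsetUr.
      rewrite (fintype.subset_trans S0S) ?finset.subsetUr //=; apply/asboolP => c c0 cS Cc.
      by apply: H; exists c.
    by move=> /setP/(_ (inr j)); rewrite !inE eqxx (negbTE jS).
  have cj : c (inr j).
    apply/negPn/negP => cj; apply: (indS c c0) Cc => x cx.
    by move: (cS x cx); rewrite !inE => /predU1P[xj|//]; rewrite xj (negbTE cj) in cx.
  exists [ffun i => c (enum_val i)]; rewrite (_ : xorL _ _ = dotL c W) //.
  apply: limfun_ext => n x; rewrite /xorL /xorf !dotLE [RHS](bigD1 (inr j)) //= cj.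
  congr (_ (+) _).
  transitivity (\sum_y ((y != inr j) && (c y && W y n x))).
    rewrite (@sum_supp _ S).
      apply: eq_bigr => i _; rewrite ffunE.
      have ei : enum_val i != inr j by apply/eqP => E; move: jS; rewrite -E enum_valP.
      by rewrite ei.
    move=> y yS; apply/negbTE; apply: contra yS => /and3P[yj cy _].
    by move: (cS y cy); rewrite !inE (negbTE yj).
  by rewrite [RHS]big_mkcond; apply: eq_bigr => y _; case: ifP.
have [c Cc] := choice rep.
exists 'I_#|S|, (fun i => enum_rank_in (hS i) (inl i)), Q',
  (fun r => comb (fun t : {ffun J -> bool} => F [ffun j => t j (+) dot (c j) r])
                 (fun j => xorL (B j) (dotL (c j) Q'))).
split => //.
- move=> i i' h; have := congr1 enum_val h.
  by rewrite !enum_rankK_in ?hS // => -[].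
- by move=> i; rewrite /Q' enum_rankK_in ?hS.
- by move=> r; apply: polylim_comb.
- rewrite (_ : glue _ _ = comb F B) //; apply: limfun_ext => n x.
  rewrite /glue /comb; congr F; apply/ffunP => j; rewrite !ffunE.
  by rewrite /xorL /xorf /dotL /comb -addbA addbb addbF.
Qed.

Lemma glue_xor (I : finType) (Q : I -> limfun) (A B : {ffun I -> bool} -> limfun) :
  xorL (glue Q A) (glue Q B) = glue Q (fun r => xorL (A r) (B r)).
Proof. by []. Qed.

Lemma mu_glue_dist k (I : finType) (Q : I -> limfun) (A B : {ffun I -> bool} -> limfun) :
  indep k Q -> (forall r, polylim k (A r)) -> (forall r, polylim k (B r)) ->
  mu (xorL (glue Q A) (glue Q B)) = (2 ^+ #|I|)^-1 * \sum_r mu (xorL (A r) (B r)).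
Proof.
by move=> IQ CA CB; rewrite glue_xor (mu_glue IQ) // => r; apply: polylim_xor.
Qed.

Lemma oddL_near M f g : oddL M f = 0 -> oddL M g <= 2 ^+ M * mu (xorL f g).
Proof.
move=> of0; rewrite -{1}(xorLK f g).
by apply: le_trans (oddL_xor M _ _) _; rewrite of0 add0r oddL_le_mu.
Qed.

(* A coarse approximation of a polynomial by functions of [Q] and of lower-degree polynomials can
   be improved without enlarging [Q]: translating the other independent polynomials of a fine
   approximation changes it on a small set, hence almost not at all by [oddL_sep]. *)
Lemma glue_refine k M (I : finType) (Q : I -> limfun) (G0 : {ffun I -> bool} -> limfun) f :
  indep k Q -> (forall r, polylim k (G0 r)) -> oddL M f = 0 -> polylim k.+1 f ->
  2 ^+ M * mu (xorL f (glue Q G0)) <= 8^-1 ->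
  forall e : R, 0 < e -> exists2 G : {ffun I -> bool} -> limfun,
    (forall r, polylim k (G r)) & mu (xorL f (glue Q G)) <= e.
Proof.
move=> IQ CG0 of0 Cf f0 e e0.
set c : R := 2 ^+ M in f0; have c0 : 0 < c by rewrite exprn_gt0.
(* The first bound is for the hypothesis of smallness in [oddL_sep], the second for the final error
   [d + 4 * c * d <= e]. *)
pose d : R := Num.min (8 * c)^-1 (e / (1 + 4 * c)).
have d0 : 0 < d by rewrite lt_min invr_gt0 divr_gt0 ?mulr_gt0 ?addr_gt0 ?mulr_gt0.
have dc : c * d <= 8^-1.
  apply: (@le_trans _ _ (c * (8 * c)^-1)); first by rewrite ler_pM2l // /d ge_min lexx.
  by rewrite invfM mulrCA mulfV ?mulr1 ?gt_eqF.
have de : d * (1 + 4 * c) <= e.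
  by rewrite -ler_pdivlMr ?addr_gt0 ?mulr_gt0 // /d ge_min lexx orbT.
have [I' [emb [Q' [G [iemb QE IQ' CG fg]]]]] := indep_extend IQ Cf d0.
set g := glue Q' G in fg.
pose res (r : {ffun I' -> bool}) : {ffun I -> bool} := [ffun i => r (emb i)].
have FE (A : {ffun I -> bool} -> limfun) : glue Q A = glue Q' (A \o res).
  apply: limfun_ext => n x; rewrite /glue /=; congr (A _ n x); apply/ffunP => i.
  by rewrite !ffunE QE.
have og : oddL M g <= c * d.
  by apply: le_trans (oddL_near g of0) _; rewrite ler_pM2l.
(* A translation that fixes the coordinates of [Q] fixes the coarse approximation [glue Q G0]. *)
have key (u : {ffun I' -> bool}) : (forall i, u (emb i) = false) ->
    mu (xorL g (glue Q' (rot u G))) <= 4 * c * d.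
  move=> uI; set E := xorL _ _.
  have rotA : rot u (G0 \o res) = G0 \o res.
    apply/funext => r; rewrite /rot /=; congr G0; apply/ffunP => i.
    by rewrite !ffunE uI addr0.
  have E1 : mu (xorL (glue Q G0) (glue Q' (rot u G))) = mu (xorL (glue Q G0) g).
    rewrite FE -{1}rotA !glue_xor -[RHS](rotation 0 u IQ') //.
    by move=> r; apply: polylim_xor => //; exact: CG0.
  (* Comparison through [glue Q G0] gives only this coarse bound, but then [oddL_sep] improves it to
     [mu E <= 2 * oddL M E]. *)
  have muE : c * mu E <= 2^-1.
    have h1 : mu E <= _ := @mu_tri R U UU m g (glue Q G0) (glue Q' (rot u G)).
    have h2 : mu (xorL (glue Q G0) g) <= _ := @mu_tri R U UU m (glue Q G0) f g.
    rewrite E1 (muC g) in h1; rewrite (muC (glue Q G0) f) in h2.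
    have h3 : mu E <= 2 * (mu (xorL f (glue Q G0)) + d) by lra.
    apply: le_trans (ler_wpM2l (ltW c0) h3) _.
    rewrite mulrCA mulrDr; lra.
  have oE : oddL M E <= 2 * (c * d).
    apply: le_trans (oddL_xor M _ _) _.
    by rewrite (rotation M u IQ' CG); lra.
  have := @oddL_sep R U UU m M E; have := @mu_ge0 R U UU m E; rewrite -/c; nra.
(* [mix q s] follows [q] on the coordinates of [Q] and [s] elsewhere, so [H s] freezes the new
   coordinates at [s] and depends on [Q] alone. On average over [s], freezing costs as much as a
   random translation of these coordinates, which [key] bounds. *)
pose mix (q : {ffun I -> bool}) (s : {ffun I' -> bool}) : {ffun I' -> bool} :=
  [ffun j => if [pick i | emb i == j] is Some i then q i else s j].
pose mask (t : {ffun I' -> bool}) : {ffun I' -> bool} :=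
  [ffun j => if [pick i | emb i == j] is Some i then false else t j].
have mixE r s : mix (res r) s = r + mask (s + r).
  apply/ffunP => j; rewrite !ffunE; case: pickP => [i /eqP<-|_]; rewrite ?ffunE ?addr0 //.
  by case: (s j); case: (r j).
have maskI t i : mask t (emb i) = false.
  by rewrite ffunE; case: pickP => // /(_ i); rewrite eqxx.
pose H s q := G (mix q s).
have CH s q : polylim k (H s q) by exact: CG.
have [s hs] := avg_exists_le (0 : {ffun I' -> bool}) (fun s => mu (xorL g (glue Q (H s)))).
exists (H s) => //.
apply: le_trans (mu_tri f g _) _; apply: le_trans de.
rewrite mulrDr mulr1; apply: lerD => //; apply: le_trans hs _.
rewrite (_ : avg _ = avg (fun t => mu (xorL g (glue Q' (rot (mask t) G))))).
  by apply: (avg_le (0 : {ffun I' -> bool})) => t; rewrite mulrC key.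
rewrite /avg; congr (_ * _).
transitivity (\sum_(t : {ffun I' -> bool}) (2 ^+ #|I'|)^-1 *
    \sum_r mu (xorL (G r) (G (r + mask (t + r))))).
  apply: eq_bigr => t _; rewrite FE (mu_glue_dist IQ') //; last by move=> r; exact: CH.
  by congr (_ * _); apply: eq_bigr => r _; rewrite /= /H mixE.
(* For each fixed [r], [t + r] runs through the same values as [t]. *)
transitivity (\sum_(t : {ffun I' -> bool}) (2 ^+ #|I'|)^-1 *
    \sum_r mu (xorL (G r) (G (r + mask t)))).
  rewrite -!big_distrr /= exchange_big [in RHS]exchange_big /=; congr (_ * _).
  by apply: eq_bigr => r _; rewrite [RHS](reindex_inj (addIr r)).
by apply: eq_bigr => t _; rewrite (mu_glue_dist IQ') // => r; exact: CG.
Qed.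

Hypothesis U_free : forall N, \forall n \near U, (N <= n)%N.

(** Diagonal argument: at index [n] follow [F t] for the last [t <= n] whose inequalities with all
    earlier terms hold at [n]. For each [s], this [t] is at least [s] for [U]-almost every [n]. *)
Lemma cauchy_complete (F : nat -> limfun) (d : nat -> R) :
  (forall s t, (s <= t)%N -> mu (xorL (F t) (F s)) < d s) ->
  exists f, forall s, mu (xorL f (F s)) <= d s.
Proof.
move=> Fd.
pose X t n := [forall s : 'I_t.+1, pr R (xorL (F t) (F s) n) < d s].
have UX t : \forall n \near U, X t n.
  have h : \forall n \near U, forall s : 'I_t.+1, pr R (xorL (F t) (F s) n) < d s.
    apply: filter_forall => s; have st : (s <= t)%N by rewrite -ltnS.
    have /cvgrPdist_lt h : (fun n => pr R (xorL (F t) (F s) n)) @ U --> mu (xorL (F t) (F s)).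
      exact: mu_cvg.
    have e0 : 0 < d s - mu (xorL (F t) (F s)) by rewrite subr_gt0 Fd.
    have := h _ e0; apply: filterS => n; rewrite ltr_norml => /andP[]; lra.
  by apply: filterS h => n h; apply/forallP.
pose r n := \max_(t < n.+1 | X t n) (t : nat).
exists (fun n => F (r n) n) => s.
apply: (cvg_le_cst (mu_cvg _)).
near=> n.
have sn : (s <= n)%N by near: n; exact: U_free.
have Xs : X s n by near: n; exact: UX.
have sr : (s <= r n)%N.
  exact: (@leq_bigmax_cond _ (fun t : 'I_n.+1 => X t n) (fun t => t : nat)
    (Ordinal (sn : s < n.+1)%N)).
have [t Xt rt] : exists2 t : 'I_n.+1, X t n & r n = t.
  rewrite /r.
  have [|t Xt ->] := @eq_bigmax_cond _ [pred t : 'I_n.+1 | X t n] (fun t => t : nat).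
    by apply/card_gt0P; exists (Ordinal (sn : s < n.+1)%N).
  by exists t.
have st : (s < t.+1)%N by rewrite ltnS -rt.
have /ltW := forallP Xt (Ordinal st).
by rewrite /xorL rt.
Unshelve. all: end_near. Qed.

(** By independence each cell of [Q] has measure [1 / c], so on every cell the pieces of better and
    better approximations form a Cauchy sequence. Their limits stay in [polylim k], which is
    closed. *)
Lemma glue_exact k (I : finType) (Q : I -> limfun) f :
  indep k Q ->
  (forall e : R, 0 < e -> exists2 G : {ffun I -> bool} -> limfun,
    (forall r, polylim k (G r)) & mu (xorL f (glue Q G)) <= e) ->
  exists2 G : {ffun I -> bool} -> limfun, (forall r, polylim k (G r)) & mu (xorL f (glue Q G)) = 0.
Proof.
move=> IQ H; pose c : R := 2 ^+ #|I|; have c1 : 1 <= c by rewrite exprn_ege1 // ler1n.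
pose d s : R := 2^-1 ^+ s; have d0 s : 0 < d s by rewrite exprn_gt0 // invr_gt0.
have ds0 s : 0 < d s / (4 * c) by rewrite divr_gt0 // mulr_gt0 //; lra.
have dmono s t : (s <= t)%N -> d t <= d s by move=> st; rewrite ler_wiXn2l //; lra.
(* Passing to one cell multiplies distances by up to [c]; the denominator [4 * c] compensates for
   this and leaves [d s / 2]. *)
pose G s := projT1 (cid2 (H _ (ds0 s))).
have CG s r : polylim k (G s r) by rewrite /G; case: (cid2 _).
have fG s : mu (xorL f (glue Q (G s))) <= d s / (4 * c) by rewrite /G; case: (cid2 _).
have GG r s t : (s <= t)%N -> mu (xorL (G t r) (G s r)) < d s.
  move=> st; have cc : c * mu (xorL (glue Q (G t)) (glue Q (G s))) <= d s / 2.
    have h : mu (xorL (glue Q (G t)) (glue Q (G s))) <= d s / (2 * c).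
      apply: le_trans (mu_tri _ f _) _; rewrite [X in X + _]muC.
      apply: le_trans (lerD (fG t) (fG s)) _.
      have -> : d s / (2 * c) = d s / (4 * c) + d s / (4 * c) by field; lra.
      by rewrite lerD2r ler_wpM2r ?dmono // invr_ge0; lra.
    apply: le_trans (ler_wpM2l (le_trans ler01 c1) h) _.
    by rewrite le_eqVlt; apply/orP; left; apply/eqP; field; lra.
  rewrite (mu_glue_dist IQ) // mulrA mulfV ?mul1r in cc; last by rewrite gt_eqF //; lra.
  rewrite (bigD1 r) //= in cc.
  have : 0 <= \sum_(i | i != r) mu (xorL (G t i) (G s i)).
    by apply: sumr_ge0 => i _; exact: mu_ge0.
  by have := d0 s; lra.
have HH r : exists h, forall s, mu (xorL h (G s r)) <= d s by apply: cauchy_complete (GG r).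
have [h hG] := choice HH.
have dlim e : 0 < e -> exists s, d s <= e.
  move=> e0; have [s hs] : exists s : nat, e^-1 <= s%:R.
    by exists (Num.truncn e^-1).+1; rewrite ltW // truncnS_gt.
  exists s; rewrite /d exprVn invf_ple ?posrE ?exprn_gt0 //.
  apply: le_trans hs _; rewrite -natrX ler_nat; exact/ltnW/ltn_expl.
have Ch r : polylim k (h r).
  apply: polylim_lim => e e0; have [s hs] := dlim _ e0.
  by exists (G s r) => //; apply: le_trans (hG r s) hs.
exists h => //; apply/eqP; rewrite eq_le mu_ge0 andbT; apply/ler_addgt0Pr => e e0.
rewrite add0r; have e2 : 0 < e / 2 by rewrite divr_gt0.
have [s hs] := dlim _ e2.
apply: le_trans (mu_tri f (glue Q (G s)) (glue Q h)) _.
rewrite (mu_glue_dist IQ) // -/c.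
have h1 : \sum_r mu (xorL (G s r) (h r)) <= c * d s.
  apply: (@le_trans _ _ (\sum_(r : {ffun I -> bool}) d s)).
    by apply: ler_sum => r _; rewrite muC hG.
  by rewrite sumr_const card_ffun card_bool -mulr_natl natrX.
have h2 : c^-1 * \sum_r mu (xorL (G s r) (h r)) <= d s.
  by rewrite mulrC ler_pdivrMr; [rewrite mulrC|lra].
have h3 : d s / (4 * c) <= d s.
  by rewrite ler_pdivrMr; have := d0 s; nra.
by have := fG s; lra.
Qed.

(** * Dyadic measure of limit polynomials *)

Definition dyadic (x : R) := exists N a : nat, x = a%:R / 2 ^+ N.

Lemma dyadicD x y : dyadic x -> dyadic y -> dyadic (x + y).
Proof.
move=> [N [a ->]] [M [b ->]]; exists (N + M)%N, (a * 2 ^ M + b * 2 ^ N)%N.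
by rewrite natrD !natrM !natrX exprD; field; rewrite !expf_neq0 ?pnatr_eq0.
Qed.

Lemma dyadic_sum (I : finType) (x : I -> R) :
  (forall i, dyadic (x i)) -> dyadic (\sum_i x i).
Proof.
move=> dx; apply: big_ind => [|y z|i _]; [|exact: dyadicD|exact: dx].
by exists 0%N, 0%N; rewrite mul0r.
Qed.

Lemma pdeg_prod (W : finZmodType) (I : Type) (r : seq I) k (f : I -> W -> bool) :
  (forall i, pdeg k (f i)) -> pdeg (size r * k).+1 (fun x => \big[andb/true]_(i <- r) f i x).
Proof.
move=> pf; elim: r => [|i r IH].
  rewrite (_ : (fun x => _) = fun=> true); first exact: pdeg_cst.
  by apply/funext => x; rewrite big_nil.
rewrite (_ : (fun x => _) = andf (f i) (fun x => \big[andb/true]_(j <- r) f j x)).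
  have -> : (size (i :: r) * k).+1 = (k + (size r * k).+1)%N by rewrite /= mulSn addnS.
  exact: pdeg_and.
by apply/funext => x; rewrite big_cons.
Qed.

Lemma oddL_sum (I : finType) M (f : I -> limfun) :
  oddL M (fun n x => \sum_i f i n x) <= \sum_i oddL M (f i).
Proof.
elim: (index_enum I) => [|i r IH].
  rewrite big_nil (_ : (fun n x => _) = fun _ _ => false).
    rewrite /oddL (ulimE (l := 0)) //; rewrite (_ : (fun n => _) = fun=> 0); first exact: cvg_cst.
    by apply/funext => n; rewrite oddcube0 //; exact: pdeg0.
  by apply: limfun_ext => n x; rewrite big_nil.
rewrite big_cons; apply: le_trans (lerD (lexx _) IH).
rewrite (_ : (fun n x => _) = xorL (f i) (fun n x => \sum_(j <- r) f j n x)).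
  exact: oddL_xor.
by apply: limfun_ext => n x; rewrite big_cons.
Qed.

Lemma oddL_and M e f g :
  pdegL e g -> oddL (M + e)%N (fun n => andf (f n) (g n)) <= 2 ^+ (M + e)%N * oddL M f.
Proof.
move=> Gg.
apply: (cvg_le_ultra (oddL_cvg _ _)
  (@cvgMl_tmp _ _ _ _ _ (2 ^+ (M + e)%N) _ (oddL_cvg _ _))) => n.
exact: oddcube_and.
Qed.

(* On [Q = r] the function [glue Q G] agrees with [G r], which is thus a sum over [u] of the
   translates of [glue Q G] cut off to [Q = r + u]. *)
Lemma oddL_slice k M (I : finType) (Q : I -> limfun) (G : {ffun I -> bool} -> limfun) r :
  indep k Q -> (forall r, polylim k (G r)) -> oddL M (glue Q G) = 0 ->
  exists M', oddL M' (G r) = 0.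
Proof.
move=> IQ CG oG; pose e := (size (index_enum I) * k.+1).+1; exists (M + e)%N.
pose ind u : limfun := fun n x => [ffun i => Q i n x] + u == r.
have indG u : pdegL e (ind u).
  move=> n; rewrite (_ : ind u n = fun x => \big[andb/true]_(i <- index_enum I)
      xorf (Q i n) (fun=> ~~ (u i (+) r i)) x).
    by apply: pdeg_prod => i; apply: pdeg_xor; [exact: (proj1 IQ)|exact: pdeg_cst].
  apply/funext => x; rewrite big_all_cond; apply/eqP/allP => [E i _|H].
    have /ffunP/(_ i) := E; rewrite !ffunE /xorf /= => <-.
    by case: (Q i n x); case: (u i).
  apply/ffunP => i; have := H i (mem_index_enum i); rewrite !ffunE /xorf /=.
  by case: (Q i n x); case: (u i); case: (r i).
have -> : G r = (fun n x => \sum_u andf (glue Q (rot u G) n) (ind u n) x).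
  apply: limfun_ext => n x; set q := [ffun i => Q i n x].
  rewrite (bigD1 (r - q)) //= big1 ?addr0.
    by rewrite /andf /ind /glue /rot -/q addrC subrK eqxx andbT.
  move=> u; rewrite /andf /ind -/q => uq; apply/negbTE; rewrite negb_and orbC.
  apply/orP; left; apply/eqP => E; by rewrite -E addrC addKr eqxx in uq.
apply/eqP; rewrite eq_le oddL_ge0 andbT; apply: le_trans (oddL_sum _ _) _.
apply: sumr_le0 => u _; apply: le_trans (oddL_and _ _ (indG u)) _.
by rewrite (rotation M u IQ CG) oG mulr0.
Qed.

(** Here [oddL M f = 0] expresses that [f] is almost everywhere a polynomial; [M] varies in the
    induction because [oddL_slice] increases it. For [k = 0] the approximations are constants, so
    the measure is 0 or 1. Otherwise [f] is almost everywhere glued from pieces of level [k], and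
    its measure is their mean over [2^#|I|] cells. *)
Theorem mu_dyadic k M f : polylim k f -> oddL M f = 0 -> dyadic (mu f).
Proof.
elim: k M f => [|k IH] M f Cf of0.
  have H e : 0 < e -> exists b : bool, `|mu f - b%:R| <= e.
    move=> e0; have [J [B [F [GB fB]]]] := Cf e e0.
    exists (F 0); have -> : (F 0)%:R = mu (comb F B).
      rewrite /mu (ulimE (l := (F 0)%:R)) // (_ : (fun n => _) = fun=> (F 0)%:R).
        exact: cvg_cst.
      apply/funext => n; rewrite -[RHS](avg_cst (0 : V n)); congr avg; apply/funext => x.
      rewrite /comb (_ : [ffun j => B j n x] = 0) //; apply/ffunP => j; rewrite !ffunE.
      exact: GB.
    have h1 := @mu_dist R U UU m f (comb F B).
    have h2 := @mu_dist R U UU m (comb F B) f; rewrite muC in h2.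
    by rewrite ler_norml; lra.
  have [->|n0] := eqVneq (mu f) 0; first by exists 0%N, 0%N; rewrite mul0r.
  have [->|n1] := eqVneq (mu f) 1; first by exists 0%N, 1%N; rewrite divr1.
  exfalso; pose e := Num.min `|mu f| `|mu f - 1| / 2.
  have e0 : 0 < e by rewrite divr_gt0 // lt_min !normr_gt0 n0 subr_eq0.
  have [b] := H e e0; have : e * 2 <= `|mu f - b%:R|.
    by rewrite /e mulfVK // ge_min; case: b; rewrite ?subr0 lexx ?orbT.
  by lra.
(* The construction starts from the empty family, which is independent. *)
have I0 : indep k (fun i : 'I_0 => (fun _ _ => false) : limfun).
  split=> [i n|c]; first exact: pdeg0.
  by move=> /eqP[]; apply/ffunP => -[].
pose eta : R := (8 * 2 ^+ M)^-1.
have eta0 : 0 < eta by rewrite invr_gt0 mulr_gt0 // exprn_gt0.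
have [I [_ [Q [G0 [_ _ IQ CG0 fG0]]]]] := indep_extend I0 Cf eta0.
have f8 : 2 ^+ M * mu (xorL f (glue Q G0)) <= 8^-1.
  apply: (@le_trans _ _ (2 ^+ M * eta)); first by rewrite ler_pM2l ?exprn_gt0.
  by rewrite /eta invfM mulrCA mulfV ?mulr1 ?expf_neq0 ?pnatr_eq0.
have [G CG fG] := glue_exact IQ (glue_refine IQ CG0 of0 Cf f8).
have oG : oddL M (glue Q G) = 0.
  apply/eqP; rewrite eq_le oddL_ge0 andbT; apply: le_trans (oddL_near _ of0) _.
  by rewrite fG mulr0.
have -> : mu f = mu (glue Q G).
  have h1 := @mu_dist R U UU m f (glue Q G).
  have h2 := @mu_dist R U UU m (glue Q G) f; rewrite muC in h2.
  by apply/eqP; rewrite eq_le; lra.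
rewrite (mu_glue IQ CG).
have [N [a ->]] : dyadic (\sum_r mu (G r)).
  by apply: dyadic_sum => r; have [M' oM'] := oddL_slice r IQ CG oG; apply: IH (CG r) oM'.
by exists (N + #|I|)%N, a; rewrite exprD invfM mulrC mulrA.
Qed.

End Independence.

Lemma third_not_dyadic (R : realType) : ~ dyadic (3^-1 : R).
Proof.
move=> [N [a E]]; have aE : a%:R = 3^-1 * 2 ^+ N :> R.
  by rewrite E mulfVK // expf_neq0 // pnatr_eq0.
have : ((3 * a)%N%:R = (2 ^ N)%N%:R :> R).
  by rewrite natrM natrX aE mulrA mulfV ?mul1r // pnatr_eq0.
move/eqP; rewrite eqr_nat => /eqP E3.
have : (3 %| 2 ^ N)%N by rewrite -E3 dvdn_mulr.
by rewrite Euclid_dvdX.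
Qed.

(** Compactness: counterexamples for all [n], taken along a free ultrafilter, form a limit
    polynomial of bias 1/3, hence of measure [(1 - 1/3) / 2 = 1/3], which is not dyadic. *)
Lemma bias_gap (R : realType) k :
  exists2 d : R, 0 < d & forall m (f : 'rV['F_2]_m -> bool), pdeg k f ->
    d <= `|bias R f - 3^-1|.
Proof.
apply: contrapT => H.
have {}H n : exists p : {m : nat & 'rV['F_2]_m -> bool},
    pdeg k (projT2 p) /\ `|bias R (projT2 p) - 3^-1| < n.+1%:R^-1.
  apply: contrapT => H'; apply: H; exists n.+1%:R^-1 => [|m f pf].
    by rewrite invr_gt0 ltr0Sn.
  by rewrite leNgt; apply/negP => lt; apply: H'; exists (existT _ m f).
have [p Hp] := choice H.
have [U [UU Uoo]] := @ultraFilterLemma nat \oo _.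
pose m n := projT1 (p n); pose f : limfun m := fun n => projT2 (p n).
have Gf : pdegL k f by move=> n; exact: (proj1 (Hp n)).
have U_free N : \forall n \near U, (N <= n)%N by apply: Uoo; exact: nbhs_infty_ge.
have bc : (fun n => bias R (f n)) @ U --> (3^-1 : R).
  apply: (cvg_trans (G := (fun n => bias R (f n)) @ \oo)).
    by move=> A; apply: Uoo.
  apply/cvgrPdist_lt => e e0; near=> n.
  rewrite distrC; apply: lt_trans (proj2 (Hp n)) _.
  near: n; exact: near_infty_natSinv_lt (PosNum e0).
have muf : mu R U f = 3^-1.
  have bc' : (fun n => bias R (f n)) @ U --> 1 - 2 * mu R U f.
    rewrite (_ : (fun n => _) = (fun n => 1 - 2 * pr R (f n))); last first.
      by apply/funext => n; exact: biasE.
    by apply: cvgB; [exact: cvg_cst|apply: (@cvgMl_tmp _ _ _ _ _ 2 _); exact: mu_cvg].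
  have h : 3^-1 = 1 - 2 * mu R U f :> R by rewrite -(ulimE bc) -(ulimE bc').
  lra.
apply: (@third_not_dyadic R); rewrite -muf.
apply: (mu_dyadic U_free (M := k) (pdegL_polylim Gf)).
apply: ulimE; rewrite (_ : (fun n => _) = fun=> 0); first exact: cvg_cst.
by apply/funext => n; rewrite oddcube0.
Unshelve. all: end_near. Qed.

(** * Distance to the Bernoulli distribution *)

Definition one2 (a : 'F_2) : bool := a == 1.

Lemma one2D a b : one2 (a + b) = one2 a (+) one2 b.
Proof. by case: a => -[|[|k]] ha //; case: b => -[|[|l]] hb. Qed.

Lemma one2M a b : one2 (a * b) = one2 a && one2 b.
Proof. by case: a => -[|[|k]] ha //; case: b => -[|[|l]] hb. Qed.

(** A coordinate satisfies [pdeg 2], so [pdeg_prod] gives [(d * 2).+1] for monomials of degree [d];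
    a bound depending on [d] alone is enough. *)
Lemma pdeg_poly (m d : nat) (f : F2vec m -> 'F_2) :
  poly_deg_le d f -> pdeg (d * 2).+1 (fun x : 'rV['F_2]_m => one2 (f x)).
Proof.
move=> [c [cd fE]].
have -> : (fun x : 'rV['F_2]_m => one2 (f x)) =
    (fun x => \sum_(S : {set 'I_m}) (one2 (c S) && \big[andb/true]_(i in S) one2 (x ord0 i))).
  apply/funext => x; rewrite fE.
  rewrite (@big_morph _ _ one2 false addb 0 +%R one2D) //.
  apply: eq_bigr => S _; rewrite one2M; congr (_ && _).
  by apply: (@big_morph _ _ one2 true andb 1 *%R one2M).
apply: (@pdeg_sum 'rV['F_2]_m) => S.
have [dS|Sd] := ltnP d #|S|.
  have -> : one2 (c S) = false by rewrite cd.
  exact: (@pdeg0 'rV['F_2]_m).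
have coord i : pdeg 2 (fun x : 'rV['F_2]_m => one2 (x ord0 i)).
  move=> y; have -> : der y (fun x : 'rV['F_2]_m => one2 (x ord0 i)) = fun=> one2 (y ord0 i).
    by apply/funext => x; rewrite /der mxE one2D addbAC addbb.
  exact: pdeg_cst.
case: (one2 (c S)); last exact: (@pdeg0 'rV['F_2]_m).
have -> : (fun x : 'rV['F_2]_m => true && \big[andb/true]_(i in S) one2 (x ord0 i)) =
          (fun x => \big[andb/true]_(i <- enum S) one2 (x ord0 i)).
  by apply/funext => x; rewrite big_enum.
apply: pdeg_leq (pdeg_prod (enum S) coord).
by rewrite -cardE ltnS leq_mul2r Sd orbT.
Qed.

(** * Lower bounds on the total variation distance *)

Section TotalVariation.
Variable R : realType.

Lemma tv_ge (T : finType) (p q : T -> R) (A : pred T) :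
  \sum_y p y = 1 -> \sum_y q y = 1 ->
  \sum_(y | A y) q y - \sum_(y | A y) p y <= 1 / 2 * \sum_y `|p y - q y|.
Proof.
move=> p1 q1; rewrite [X in _ <= _ * X](bigID A) /=.
have h1 : \sum_(y | A y) q y - \sum_(y | A y) p y <= \sum_(y | A y) `|p y - q y|.
  by rewrite -sumrB; apply: ler_sum => y _; rewrite distrC; exact: ler_norm.
have h2 : \sum_(y | ~~ A y) p y - \sum_(y | ~~ A y) q y <= \sum_(y | ~~ A y) `|p y - q y|.
  by rewrite -sumrB; apply: ler_sum => y _; exact: ler_norm.
rewrite (bigID A) /= in p1; rewrite (bigID A) /= in q1; lra.
Qed.

Lemma tv_ge0 (T : finType) (p q : T -> R) : 0 <= 1 / 2 * \sum_y `|p y - q y|.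
Proof. by rewrite mulr_ge0 ?divr_ge0 // sumr_ge0. Qed.

(* [poly_law] and, below, [ber13n], over an arbitrary [realType]. *)
Definition plaw (n m : nat) (P : 'I_n -> 'rV['F_2]_m -> 'F_2) (y : 'rV['F_2]_n) : R :=
  avg (fun x : 'rV['F_2]_m => ((\row_i P i x) == y)%:R).

Lemma sum_plaw (n m : nat) (P : 'I_n -> 'rV['F_2]_m -> 'F_2) (A : pred 'rV['F_2]_n) :
  \sum_(y | A y) plaw P y = pr R (fun x : 'rV['F_2]_m => A (\row_i P i x)).
Proof.
rewrite big_mkcond /pr.
transitivity (\sum_(y : 'rV['F_2]_n) avg (fun x : 'rV['F_2]_m =>
    (A y && ((\row_i P i x) == y))%:R : R)).
  apply: eq_bigr => y _; case: (A y) => //=.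
  by rewrite (avg_cst (0 : 'rV['F_2]_m)).
rewrite -avg_sum; congr avg; apply/funext => x.
rewrite (bigD1 (\row_i P i x)) //= eqxx andbT big1 ?addr0 //.
by move=> y yx; rewrite eq_sym (negbTE yx) andbF.
Qed.

Definition bw (a : 'F_2) : R := if a == 1 then 1 / 3 else 2 / 3.

Definition ber (n : nat) (y : 'rV['F_2]_n) : R := \prod_(i < n) bw (y ord0 i).

Lemma sum_F2 (h : 'F_2 -> R) : \sum_a h a = h 0 + h 1.
Proof.
rewrite (bigD1 (0 : 'F_2)) //= (bigD1 (1 : 'F_2)) //= big1 ?addr0 //.
by case=> -[|[|k]] hk.
Qed.

Lemma sum_F2vec (n : nat) (h : 'rV['F_2]_n -> R) :
  \sum_y h y = \sum_(f : {ffun 'I_n -> 'F_2}) h (\row_i f i).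
Proof.
apply: (reindex (fun f : {ffun 'I_n -> 'F_2} => \row_i f i : 'rV['F_2]_n)); apply: onW_bij.
exists (fun y : 'rV['F_2]_n => [ffun i => y ord0 i]) => [f|y].
  by apply/ffunP => i; rewrite ffunE mxE.
by apply/rowP => i; rewrite mxE ffunE.
Qed.

Lemma sum_ber (n : nat) : \sum_(y : 'rV['F_2]_n) ber y = 1.
Proof.
rewrite sum_F2vec -[RHS](@sum_iid R _ bw n); last by rewrite sum_F2 /bw eqxx /=; lra.
by apply: eq_bigr => f _; apply: eq_bigr => i _; rewrite mxE.
Qed.

(** Chebyshev's inequality: the sign of a Bernoulli(1/3) bit has mean [2/3 - 1/3 = 1/3] and variance
    at most 1. *)
Lemma ber_concentration (n s : nat) (io : 'I_s.+1 -> 'I_n) (de : R) : injective io -> 0 < de ->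
  \sum_(y : 'rV['F_2]_n | ~~ (`|avg (fun a => sg R (one2 (y ord0 (io a)))) - 3^-1| <= de)) ber y
    <= (s.+1%:R * de ^+ 2)^-1.
Proof.
move=> iio de0; pose g (a : 'F_2) : R := sg R (one2 a) - 3^-1.
pose S : {set 'I_n} := (io @: [set: 'I_s.+1])%SET.
have cS : #|S| = s.+1 by rewrite card_imset // cardsT card_ord.
have w1 : \sum_a bw a = 1 by rewrite sum_F2 /bw eqxx /=; lra.
have wg : \sum_a bw a * g a = 0.
  by rewrite sum_F2 /bw /g /one2 eqxx /= /sg expr0 expr1; lra.
have := sum_iid_sqr S w1 wg; rewrite cS => var.
have wg2 : \sum_a bw a * g a ^+ 2 <= 1.
  by rewrite sum_F2 /bw /g /one2 eqxx /= /sg expr0 expr1; lra.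
have s0 : 0 < s.+1%:R :> R by rewrite ltr0Sn.
have d2 : 0 < de ^+ 2 by rewrite exprn_gt0.
have b0 (y : 'rV['F_2]_n) : 0 <= ber y.
  by apply: prodr_ge0 => i _; rewrite /bw; case: ifP => _; lra.
rewrite invfM ler_pdivlMr // big_distrl /=.
apply: (@le_trans _ _ (\sum_(y : 'rV['F_2]_n)
    ber y * (s.+1%:R^-1 * \sum_(i in S) g (y ord0 i)) ^+ 2)).
  rewrite [leRHS](bigID (fun y : 'rV['F_2]_n =>
    ~~ (`|avg (fun a => sg R (one2 (y ord0 (io a)))) - 3^-1| <= de))) /=.
  rewrite -[leLHS]addr0; apply: lerD; last first.
    by apply: sumr_ge0 => y _; rewrite mulr_ge0 // sqr_ge0.
  apply: ler_sum => y; rewrite -ltNge => hy; apply: ler_wpM2l => //.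
  have -> : s.+1%:R^-1 * \sum_(i in S) g (y ord0 i) =
            avg (fun a => sg R (one2 (y ord0 (io a)))) - 3^-1.
    rewrite /S big_imset /=; last by move=> a b _ _; exact: iio.
    rewrite -[3^-1](avg_cst (ord0 : 'I_s.+1)) -avgB /avg card_ord; congr (_ * _).
    by apply: eq_bigl => a; rewrite inE.
  by rewrite -[leRHS]ger0_norm ?sqr_ge0 // normrX lerXn2r // ?nnegrE ?ltW.
rewrite sum_F2vec.
have -> : \sum_(f : {ffun 'I_n -> 'F_2}) ber (\row_i f i) *
     (s.+1%:R^-1 * \sum_(i in S) g ((\row_i f i) ord0 i)) ^+ 2 =
   s.+1%:R^-2 * (s.+1%:R * \sum_a bw a * g a ^+ 2).
  rewrite -var big_distrr /=; apply: eq_bigr => f _; rewrite exprMn exprVn mulrCA.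
  congr (_ * (_ * _ ^+ 2)); first by apply: eq_bigr => i _; rewrite mxE.
  by apply: eq_bigr => i _; rewrite mxE.
rewrite expr2 invfM mulrA -[_ * _ * s.+1%:R]mulrA mulVf ?gt_eqF // mulr1.
by rewrite ler_piMr // invr_ge0 ltW.
Qed.

Lemma tv_lower (K : nat) (ep : R) : 0 < ep ->
  exists N : nat, forall n m (P : 'I_n -> 'rV['F_2]_m -> 'F_2),
  (N <= n)%N -> (forall i, pdeg K (fun x => one2 (P i x))) ->
  1 - ep <= 1 / 2 * \sum_(y : 'rV['F_2]_n) `|plaw P y - ber y|.
Proof.
move=> ep0; have ep2 : 0 < ep / 2 by rewrite divr_gt0.
have [d d0 gap] := bias_gap R K.
have [s [de [de' [de0 de'0 sde' fam]]]] := family_bound d0 ep2 gap.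
pose q := Num.truncn (2 / de).
have [N HN] := ramsey (ord0 : 'I_q.+1) s.+1.
exists N => n m P Nn PK.
pose cor (i j : 'I_n) : R := avg (fun x : 'rV['F_2]_m => sg R (one2 (P i x)) * sg R (one2 (P j x))).
have corC i j : cor i j = cor j i by congr avg; apply/funext => x; rewrite mulrC.
have cor1 i j : `|cor i j| <= 1.
  apply: le_trans (ler_norm_avg _) _; apply: (avg_le (0 : 'rV['F_2]_m)) => x.
  by rewrite normrM !norm_sg mulr1.
(* Pairs are coloured by their correlation, rounded in steps of [de]; the interval from -1 to 1
   needs [q + 1] colours. *)
pose chi (i j : 'I_n) : 'I_q.+1 := inord (Num.truncn ((cor i j + 1) / de)).
have cor_ge i j : 0 <= (cor i j + 1) / de.
  by rewrite divr_ge0 ?(ltW de0) //; have := cor1 i j; rewrite ler_norml => /andP[]; lra.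
have chiE i j : chi i j = Num.truncn ((cor i j + 1) / de) :> nat.
  rewrite /chi inordK // ltnS; apply: Num.Theory.le_truncn.
  by rewrite ler_pM2r ?invr_gt0 //; have := cor1 i j; rewrite ler_norml => /andP[]; lra.
have chi_close i j i' j' : chi i j = chi i' j' -> `|cor i j - cor i' j'| <= de.
  move=> /(congr1 (@nat_of_ord _)); rewrite !chiE => E.
  have /andP[h1 h2] := truncn_itv (cor_ge i j).
  have /andP[h3 h4] := truncn_itv (cor_ge i' j').
  rewrite E in h1 h2; rewrite !(ler_pdivlMr, ltr_pdivrMr) // in h1 h2 h3 h4.
  rewrite -natr1 in h2 h4; rewrite ler_norml; apply/andP; split; nra.
have Ne : (N <= size (enum 'I_n))%N by rewrite size_enum_ord.
have [c [l [sub sz pw]]] := HN _ chi _ Ne.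
have ul : uniq l by apply: subseq_uniq sub _; exact: enum_uniq.
have [i0 _] : exists i0 : 'I_n, true by case: l sz {sub pw ul} => // i l _; exists i.
pose io (a : 'I_s.+1) := nth i0 l a.
have iio : injective io.
  move=> a b /eqP; rewrite nth_uniq ?sz // => /eqP; exact: val_inj.
have chic (a b : 'I_s.+1) : (a < b)%N -> chi (io a) (io b) = c.
  by move=> ab; apply/eqP; apply: (pairwiseP i0 pw) => //; rewrite inE sz.
(* Any pair of the monochromatic family can serve as reference. For [s = 0] this pair is degenerate,
   but then no distinct [a] and [b] exist. *)
pose be := cor (io ord0) (io ord_max).
have corbe a b : a != b -> `|cor (io a) (io b) - be| <= de.
  wlog ab : a b / (a < b)%N => [wl|_].
    by rewrite neq_ltn => /orP[h|h]; [|rewrite corC]; apply: wl; rewrite // neq_ltn h.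
  apply: chi_close; rewrite !chic //=.
  by apply: leq_ltn_trans (leq0n a) _; apply: leq_trans ab _; rewrite -ltnS.
pose A (y : 'rV['F_2]_n) := `|avg (fun a => sg R (one2 (y ord0 (io a)))) - 3^-1| <= de'.
have pA : \sum_(y | A y) plaw P y <= ep / 2.
  rewrite sum_plaw; apply: le_trans (fam m (fun a x => one2 (P (io a) x)) be _ _ _) => //.
    rewrite le_eqVlt; apply/orP; left; apply/eqP; congr pr; apply/funext => x.
    by rewrite /A; congr (`|avg _ - _| <= _); apply/funext => a; rewrite mxE.
  by rewrite /be cor1.
have p1 : \sum_(y : 'rV['F_2]_n) plaw P y = 1.
  by rewrite (sum_plaw P xpredT); exact: (avg_cst (0 : 'rV['F_2]_m)).
have qA : \sum_(y | ~~ A y) ber y <= ep / 2.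
  by apply: le_trans (ber_concentration iio de'0) sde'.
apply: le_trans (tv_ge A p1 (sum_ber n)).
by have := sum_ber n; rewrite (bigID A) /= => h; lra.
Qed.

End TotalVariation.

Lemma cvg_to0 (K : realType) (u : nat -> K) :
  (forall e : K, 0 < e -> \forall n \near \oo, `|u n| <= e) -> u @ \oo --> (0 : K).
Proof.
move=> H; apply/cvgrPdist_le => e e0; near=> n; rewrite sub0r normrN.
by near: n; exact: H.
Unshelve. all: end_near. Qed.

Lemma tv_dist_lower (d : nat) (ep : R) : 0 < ep ->
  exists N : nat, forall n m (P : 'I_n -> F2vec m -> 'F_2), (N <= n)%N ->
    (forall i, poly_deg_le d (P i)) -> 1 - ep <= tv_dist (poly_law P) (@ber13n n).
Proof.
move=> ep0; have [N H] := tv_lower (d * 2).+1 ep0.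
exists N => n m P Nn Pd; apply: le_trans (H n m P Nn (fun i => pdeg_poly (Pd i))) _.
rewrite le_eqVlt; apply/orP; left; apply/eqP; congr (_ * _); apply: eq_bigr => y _.
congr (`|_ - _|).
rewrite /poly_law /plaw /avg mulrC card_mx card_Fp // mul1n natrX; congr (_ * _).
rewrite -sum1_card natr_sum [RHS]big_mkcond; apply: eq_bigr => x _; rewrite inE.
by case: eqP.
Qed.

Lemma tv_dist_ge0 (T : finType) (p q : T -> R) : 0 <= tv_dist p q.
Proof.
exact: (@tv_ge0 R).
Qed.

Theorem theorem12p2 :
  (exists C : R, 0 < C /\
    forall (eps : R) (d : nat), 0 < eps -> eps <= 1 ->
    exists eps' d' : R, 0 < eps' /\ 0 < d' /\
      forall (n m : nat) (P : 'I_n -> F2vec m -> 'F_2),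
        (0 < n)%nat ->
        (forall i, poly_deg_le d (P i)) ->
        1 - C * d' * (n%:R `^ (- eps')) - C * eps
          <= tv_dist (poly_law P) (@ber13n n))
  /\
  (forall d : nat, exists eta : nat -> R,
    eta @ \oo --> (0 : R) /\
    forall (n m : nat) (P : 'I_n -> F2vec m -> 'F_2),
      (forall i, poly_deg_le d (P i)) ->
      1 - eta n <= tv_dist (poly_law P) (@ber13n n)).
Proof.
split.
  exists 1; split; first exact: ltr01.
  move=> eps d eps0 _; have [N H] := tv_dist_lower d eps0.
  (* With [d' = N + 1] and exponent 1 the bound is trivial for [n < N], as then [d' / n >= 1]. *)
  exists 1, N.+1%:R; split; first exact: ltr01.
  split; first by rewrite ltr0Sn.
  move=> n m P n0 Pd; rewrite !mul1r powR_inv1 ?ler0n //.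
  have nR : 0 < n%:R :> R by rewrite ltr0n.
  have [Nn|nN] := leqP N n.
    apply: le_trans (H n m P Nn Pd); rewrite lerD2r gerBl divr_ge0 ?ler0n //.
  apply: le_trans (tv_dist_ge0 _ _); rewrite subr_le0.
  apply: (@le_trans _ _ 0); last exact: ltW.
  by rewrite subr_le0 ler_pdivlMr // mul1r ler_nat ltnW // ltnS ltnW.
move=> d.
(* The function [eta n] is the infimum of the errors valid for all [m] and [P] at once; 1 is always
   such an error. *)
pose E n : set R := [set e | 0 <= e /\ forall m (P : 'I_n -> F2vec m -> 'F_2),
  (forall i, poly_deg_le d (P i)) -> 1 - tv_dist (poly_law P) (@ber13n n) <= e].
have E1 n : E n 1.
  by split=> [|m P _]; [exact: ler01|rewrite gerBl tv_dist_ge0].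
have Elb n : has_lbound (E n) by exists 0 => e [].
exists (fun n => inf (E n)); split.
  apply: (@cvg_to0 R) => e e0; have [N H] := tv_dist_lower d e0.
  near=> n; rewrite ger0_norm.
    apply: ge_inf => //; split=> [|m P Pd]; first exact: ltW.
    rewrite lerBlDr addrC -lerBlDr; apply: H => //; near: n; exact: nbhs_infty_ge.
  by apply: lb_le_inf; [exists 1|move=> x []].
move=> n m P Pd; rewrite lerBlDr addrC -lerBlDr.
by apply: lb_le_inf => [|e [_]]; [exists 1|apply].
Unshelve. all: end_near. Qed.
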